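(* Let $m$ be a positive integer that is odd and satisfies $m \not\equiv 0 \pmod 3$, let $q = 3^m$, let $u \in \mathbb{F}_q^*$, and let $$D_u = \{ \mathcal{D}_7(x^2,u) : x \in \mathbb{F}_q^* \}, \qquad \mathcal{D}_7(x,u) = x^7 - u x^5 - u^2 x^3 - u^3 x .$$ Then $D_u$ is a skew Hadamard difference set in the additive group $(\mathbb{F}_q,+)$.
   Context: $\mathbb{F}_q$ is the finite field with $q$ elements and $\mathbb{F}_q^* = \mathbb{F}_q\setminus\{0\}$. The Dickson polynomial of the first kind of order $n$ is $\mathcal{D}_n(x,u) = \sum_{j=0}^{\lfloor n/2\rfloor} \frac{n}{n-j}\binom{n-j}{j}(-u)^j x^{n-2j}$; in characteristic $3$ with $n=7$ it is the polynomial $\mathcal{D}_7(x,u)$ displayed in the claim. Let $(G,+)$ be a finite group of order $v$. A $k$-element subset $D\subseteq G$ is a $(v,k,\lambda)$ difference set if the list of differences $d_1-d_2$ with $d_1,d_2\in D$, $d_1\neq d_2$, contains each nonzero element of $G$ exactly $\lambda$ times. A difference set $D$ in $G$ is called skew Hadamard if $G$ is the disjoint union of $D$, $-D=\{-d: d\in D\}$ and $\{0\}$. *)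

(* Defs.v *)
From HB Require Import structures.
From mathcomp Require Import all_boot all_order all_algebra.
From mathcomp Require Import ring zify.

Set Implicit Arguments.
Unset Strict Implicit.
Unset Printing Implicit Defensive.

Import GRing.Theory.
Local Open Scope ring_scope.

Definition dickson_coef (n j : nat) : nat := (n * 'C(n - j, j) %/ (n - j))%N.

(* The truncating division in [dickson_coef] is exact over the whole range of
   summation used below. *)
Lemma dickson_coefK (n j : nat) : (0 < n)%N -> (j.*2 <= n)%N ->
  (dickson_coef n j * (n - j) = n * 'C(n - j, j))%N.
Proof.
move=> n_gt0 le_jn; apply: divnK.
have -> : (n * 'C(n - j, j) = (n - j) * 'C(n - j, j) + j * 'C(n - j, j))%N.
  by rewrite -mulnDl subnK //; lia.
rewrite (dvdn_addr _ (dvdn_mulr _ (dvdnn _))).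
case: j le_jn => [|j] le_jn; first by rewrite mul0n dvdn0.
have -> : (n - j.+1)%N = (n - j.+1).-1.+1 by lia.
by rewrite -mul_bin_diag dvdn_mulr.
Qed.

(* The Dickson polynomial of the first kind, D_n(X, u), for n > 0.  The closed
   formula reads 0/0 at n = 0, where this definition yields 0 rather than the
   customary 2. *)
Definition dickson (R : comNzRingType) (n : nat) (u : R) : {poly R} :=
  \sum_(j < n./2.+1) ((dickson_coef n j)%:R * (- u) ^+ j) *: 'X^(n - j.*2).

Lemma dickson7_char3 (R : comNzRingType) (u : R) : 3%:R = 0 :> R ->
  dickson 7 u = 'X^7 - u *: 'X^5 - u ^+ 2 *: 'X^3 - u ^+ 3 *: 'X.
Proof.
move=> R3; rewrite /dickson !big_ord_recl big_ord0 /= addr0.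
have c0 : dickson_coef 7 0 = 1%N by [].
have c1 : dickson_coef 7 1 = 7%N by [].
have c2 : dickson_coef 7 2 = 14%N by [].
have c3 : dickson_coef 7 3 = 7%N by [].
have e7 : 7%:R = 1 :> R by rewrite -[7%N]/(1 + 2 * 3)%N natrD natrM R3 mulr0 addr0.
have e14 : 14%:R = -1 :> R.
  by apply/eqP; rewrite -addr_eq0 -mulrSr -[15%N]/(5 * 3)%N natrM R3 mulr0.
rewrite /bump /= c0 c1 c2 c3 e7 e14 /= !subnE /=.
rewrite expr0 mulr1 scale1r !mul1r !addn0 !addn1 mulN1r expr1.
rewrite sqrrN [(- u) ^+ 3]exprNn -signr_odd expr1 mulN1r !scaleNr.
by rewrite !addrA.
Qed.

(* [lambda] counts ordered pairs of D x D, i.e. multiplicity in the list of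
   differences d1 - d2.  [finZmodType] restricts to abelian groups. *)
Definition difference_set (G : finZmodType) (v k lambda : nat) (D : {set G}) :
    Prop :=
  [/\ #|G| = v, #|D| = k &
      forall g : G, g != 0 ->
        #|[set d : G * G | [&& d.1 \in D, d.2 \in D, d.1 != d.2
                             & d.1 - d.2 == g]]| = lambda].

Definition opp_set (G : finZmodType) (D : {set G}) : {set G} :=
  [set - d | d in D].

Definition skew_hadamard_difference_set (G : finZmodType) (D : {set G}) :
    Prop :=
  (exists v k lambda : nat, difference_set v k lambda D) /\
  [/\ [set: G] = D :|: opp_set D :|: [set 0],
      [disjoint D & opp_set D],
      [disjoint D & [set (0 : G)]] &
      [disjoint opp_set D & [set (0 : G)]]].

Definition dickson7_set (F : finFieldType) (u : F) : {set F} :=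
  [set (dickson 7 u).[x ^+ 2] | x in [set~ (0 : F)]].

(* Main.v *)
Require Import Defs.
From HB Require Import structures.
From mathcomp Require Import all_boot all_order all_algebra.
From mathcomp Require Import all_fingroup all_solvable all_field.
From mathcomp Require Import ring zify.
Set Implicit Arguments.
Unset Strict Implicit.
Unset Printing Implicit Defensive.
Import Order.TTheory GRing.Theory Num.Theory.
Local Open Scope ring_scope.

(** Let q = 3^m and let w be a primitive cube root of unity.  Let chi be a
    multiplicative character of F of order q - 1, let eta = chi^((q-1)/2) be the
    quadratic character and let psi(y) = w^(Tr y).

    The map D_7 is an odd permutation of F (lemma [dickson7_fun_inj]; this is where
    m must not be divisible by 3), and -1 is not a square because m is odd.  As D_u
    is the image of the nonzero squares, F is the disjoint union of D_u, - D_u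
    and 0.
    The character sums of D_u are (S(a) - 1) / 2, where
      S(a) = sum over x of eta(x) psi(a D_7(x)),
    so by Fourier inversion D_u is a difference set if S(a)^2 = - q for all a <> 0
    (lemmas [half_sum_mul] and [nb_diff_count]).

    Since eta and D_7 are odd, S(a) = M(a) (w - w^2) for an integer M(a), and
    (w - w^2)^2 = -3.  The integer M(a) is odd because D_7 is a permutation, and
    the mean of M(a)^2 over a <> 0 is 3^(m-1) by Parseval's identity.  Hence it
    suffices that 3^((m-1)/2) divides every M(a): then each square is at least the
    mean, and all of them are equal to it ([imag_sum_sqr]).

    The divisibility is read off at a prime above 3 in Z[z, w], where z generates
    the values of chi.  Each factor psi(c x^e) of psi(a D_7(x)) is expanded in powers
    of chi; its coefficients are Gauss sums, and the coefficient of chi^j is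
    divisible by (1 - w)^s(j), where s(j) is the sum of the ternary digits of j
    ([gauss_valuation], the lower bound in Stickelberger's theorem).  After
    summation over x only the terms with
      7 j1 + 5 j2 + 3 j3 + j4 = (q - 1) / 2 modulo q - 1
    survive, and for these s(j1) + s(j2) + s(j3) + s(j4) >= m by an analysis of the
    carries ([weight_bound]).  So (1 - w)^m divides S(a), which is enough because
    (1 - w)^2 is 3 times a unit. *)

(** * The Dickson polynomial of order 7 permutes F *)

Definition dickson7_fun (R : comNzRingType) (u x : R) : R :=
  x ^+ 7 - u * x ^+ 5 - u ^+ 2 * x ^+ 3 - u ^+ 3 * x.

Lemma horner_dickson7 (R : comNzRingType) (u x : R) : 3%:R = 0 :> R ->
  (dickson 7 u).[x] = dickson7_fun u x.
Proof. by move=> R3; rewrite dickson7_char3 // /dickson7_fun !hornerE. Qed.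

Lemma dickson7_funN (R : comNzRingType) (u x : R) :
  dickson7_fun u (- x) = - dickson7_fun u x.
Proof. by rewrite /dickson7_fun; ring. Qed.

Lemma dickson7_fun0 (R : comNzRingType) (u : R) : dickson7_fun u 0 = 0.
Proof. by rewrite /dickson7_fun; ring. Qed.

Lemma cubeD_char3 (R : comNzRingType) (x y : R) : 3%:R = 0 :> R ->
  (x + y) ^+ 3 = x ^+ 3 + y ^+ 3.
Proof.
move=> R3; transitivity (x ^+ 3 + y ^+ 3 + 3%:R * (x ^+ 2 * y + x * y ^+ 2)).
  by ring.
by rewrite R3 mul0r addr0.
Qed.

Lemma exp3XD_char3 (R : comNzRingType) (n : nat) (x y : R) : 3%:R = 0 :> R ->
  (x + y) ^+ (3 ^ n) = x ^+ (3 ^ n) + y ^+ (3 ^ n).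
Proof.
move=> R3; elim: n => [|n IHn]; rewrite ?expr1 // expnSr !exprM IHn.
exact: cubeD_char3.
Qed.

(** In characteristic 3 this is the minimal polynomial c^3 + c^2 - 2 c - 1 of
    t + t^-1 for a primitive seventh root of unity t. *)
Definition cubic (R : comNzRingType) (c : R) := c ^+ 3 + c ^+ 2 + c - 1.

Section Cubic.
Variables (K : comNzRingType) (K3 : 3%:R = 0 :> K).

Lemma cubic_cube (c : K) : cubic c = 0 -> c ^+ 3 = 1 - c - c ^+ 2.
Proof. by move=> Pc; rewrite -[LHS]subr0 -Pc /cubic; ring. Qed.

Lemma cubic_ninth (c : K) : cubic c = 0 -> c ^+ 9 = c ^+ 2 + 1.
Proof.
move=> Pc; rewrite (exprM c 3 3) (cubic_cube Pc).
(* Euclidean division by the cubic, with remainder reduced modulo 3. *)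
transitivity (c ^+ 2 + 1 + (- c ^+ 3 - c ^+ 2 *+ 2 + c *+ 3 + 3) * cubic c
    + 3%:R * (- (c ^+ 2 *+ 3) - c + 1)).
  by rewrite /cubic; ring.
by rewrite Pc K3 mulr0 mul0r !addr0.
Qed.

(** The cube map permutes the three roots t + t^-1 cyclically: 3 has order 6
    modulo 7, hence order 3 modulo 7 up to sign. *)
Lemma cubic_27th (c : K) : cubic c = 0 -> c ^+ 27 = c.
Proof.
move=> Pc; rewrite (exprM c 9 3) (cubic_ninth Pc).
transitivity (c + (c ^+ 3 - c ^+ 2 + c *+ 3 - 1) * cubic c + 3%:R * c).
  by rewrite /cubic; ring.
by rewrite Pc K3 mulr0 mul0r !addr0.
Qed.

(** The conjugates of c are c^3 and c^9, so the product is a norm, computed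
    from the elementary symmetric functions -1, 1, 1 of the roots. *)
Lemma norm_cubic (c al be ga : K) : cubic c = 0 ->
  let Q (t : K) := al - t * be + t ^+ 2 * ga in
  Q c * Q (c ^+ 3) * Q (c ^+ 9)
  = al ^+ 3 + al ^+ 2 * be - al ^+ 2 * ga + al * be ^+ 2 + al * be * ga
    - be ^+ 3 - be ^+ 2 * ga - be * ga ^+ 2 + ga ^+ 3.
Proof.
move=> Pc Q; have c3 := cubic_cube Pc; have c9 := cubic_ninth Pc.
have e1 : c + c ^+ 3 + c ^+ 9 = - 1 + 3%:R by rewrite c3 c9; ring.
have e2 : c * c ^+ 3 + c * c ^+ 9 + c ^+ 3 * c ^+ 9 = 1.
  transitivity (1 - c * cubic c); last by rewrite Pc; ring.
  by rewrite c3 c9 /cubic; ring.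
have e3 : c * c ^+ 3 * c ^+ 9 = 1 + 3%:R * (- c ^+ 2).
  transitivity (1 + 3%:R * (- c ^+ 2) + (1 - c ^+ 2) * cubic c).
    by rewrite c3 c9 /cubic; ring.
  by rewrite Pc mulr0 addr0.
rewrite K3 ?mul0r !addr0 in e1 e3.
rewrite /Q; move: (c ^+ 3) (c ^+ 9) e1 e2 e3 => b d.
set s1 := c + b + d; set s2 := c * b + c * d + b * d; set s3 := c * b * d.
move=> e1 e2 e3.
transitivity (al ^+ 3 - al ^+ 2 * be * s1 + al ^+ 2 * ga * (s1 ^+ 2 - s2 *+ 2)
  + al * be ^+ 2 * s2 - al * be * ga * (s1 * s2 - s3 *+ 3)
  + al * ga ^+ 2 * (s2 ^+ 2 - (s1 * s3) *+ 2) - be ^+ 3 * s3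
  + be ^+ 2 * ga * s1 * s3 - be * ga ^+ 2 * s2 * s3 + ga ^+ 3 * s3 ^+ 2).
  by rewrite /s1 /s2 /s3; ring.
rewrite e1 e2 e3 -[RHS]addr0 -(mul0r (al * be * ga + al * ga ^+ 2)) -K3.
by ring.
Qed.

(** Writing x = t + u/t turns D_7(x, u) into t^7 + (u/t)^7, and the seven values
    of y with the same image come from multiplying t by a seventh root of unity;
    pairing inverse roots gives one linear and three quadratic factors. *)
Lemma dickson7_fun_factor (c u x y : K) : cubic c = 0 ->
  let Q (t : K) := x ^+ 2 + y ^+ 2 - u - t * (x * y) + t ^+ 2 * u in
  dickson7_fun u x - dickson7_fun u y = (x - y) * (Q c * Q (c ^+ 3) * Q (c ^+ 9)).
Proof.
move=> Pc Q; rewrite /Q norm_cubic //.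
(* [r] is the quotient by 3 of the difference of the two sides over Z. *)
pose r := - (x ^+ 5 * y ^+ 2) + x ^+ 5 * u + x ^+ 4 * y ^+ 3 - x ^+ 4 * y * u
  - x ^+ 3 * y ^+ 4 + x ^+ 3 * y ^+ 2 * u *+ 3 - x ^+ 3 * u ^+ 2 *+ 2
  + x ^+ 2 * y ^+ 5 - x ^+ 2 * y ^+ 3 * u *+ 3 + x ^+ 2 * y * u ^+ 2 *+ 2
  + x * y ^+ 4 * u - x * y ^+ 2 * u ^+ 2 *+ 2 - y ^+ 5 * u
  + y ^+ 3 * u ^+ 2 *+ 2.
by rewrite -[RHS]addr0 -(mul0r r) -K3 /r /dickson7_fun; ring.
Qed.
End Cubic.

Lemma natr3_card (m : nat) (F : finFieldType) :
  (0 < m)%N -> #|F| = (3 ^ m)%N -> 3%:R = 0 :> F.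
Proof.
move=> m_gt0 cardF; have : (3 ^ m)%:R = 0 :> F.
  by rewrite -cardF -cardsT -FinRing.zmodXgE expg_cardG ?inE.
by rewrite natrX => /eqP; rewrite expf_eq0 m_gt0 => /eqP.
Qed.

Section Injective.
Variables (m : nat) (F : finFieldType) (u : F).
Hypotheses (m_mod3 : (m != 0 %[mod 3])%N) (cardF : #|F| = (3 ^ m)%N).
Hypothesis u_neq0 : u != 0.

(** Suppose that one of the quadratic factors vanishes at a root c of the cubic
    in an algebraic closure.  As a polynomial in c it has degree 2, leading
    coefficient u and coefficients fixed by x |-> x^q.  Since 3 does not divide m,
    the powers of this automorphism carry c to each of the roots c, c^3, c^9, which
    are distinct: a nonzero polynomial of degree 2 would have three roots. *)
Lemma dickson7_fun_inj : injective (dickson7_fun u).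
Proof.
move=> x y eq_xy; apply/eqP; rewrite -subr_eq0; apply/negPn/negP => neq_xy.
have m_gt0 : (0 < m)%N by case: m m_mod3.
have F3 := natr3_card m_gt0 cardF.
have [K [f _]] := countable_algebraic_closure F.
have K3 : 3%:R = 0 :> K by rewrite -(rmorph_nat f) F3 rmorph0.
have [c Pc] : exists c : K, cubic c = 0.
  have [c] := @solve_monicpoly K 3 (nth 0 [:: 1; -1; -1]) isT.
  rewrite !big_ord_recl big_ord0 /= /bump /= => c3; exists c.
  by rewrite /cubic c3; ring.
have fq (t : F) : f t ^+ (3 ^ m) = f t by rewrite -rmorphXn /= -cardF expf_card.
have cubeN (n : nat) (s : K) : (- s) ^+ (3 ^ n) = - s ^+ (3 ^ n).
  by rewrite exprNn -signr_odd oddX orbT mulN1r.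
pose Q (t : K) := f x ^+ 2 + f y ^+ 2 - f u - t * (f x * f y) + t ^+ 2 * f u.
have Qq t : Q t ^+ (3 ^ m) = Q (t ^+ (3 ^ m)).
  rewrite /Q !exp3XD_char3 // !cubeN (exprAC (f x)) (exprAC (f y)) !fq.
  rewrite (exprMn _ (t ^+ 2) (f u)) (exprMn _ t (f x * _)) (exprMn _ (f x) (f y)).
  by rewrite !fq (exprAC t).
have Q0 : Q c * Q (c ^+ 3) * Q (c ^+ 9) = 0.
  have /eqP : f x - f y != 0 by rewrite -rmorphB fmorph_eq0.
  move/eqP => nz; apply: (mulfI nz); rewrite mulr0 -dickson7_fun_factor //.
  have fD t : dickson7_fun (f u) (f t) = f (dickson7_fun u t).
    by rewrite /dickson7_fun -!rmorphXn -!rmorphM -!rmorphB.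
  by rewrite !fD eq_xy subrr.
have c27 := cubic_27th K3 Pc.
(* A fixed point of the cube map lies in F_3, which contains no root. *)
have nfix : c ^+ 3 <> c.
  move=> c3; have P' := Pc; rewrite /cubic c3 in P'.
  have c1 : c ^+ 2 = 1 + c.
    apply/eqP; rewrite -subr_eq0 -P' -[X in _ == X]subr0 -(mul0r c) -K3.
    by apply/eqP; ring.
  have : c ^+ 3 = c * (1 + c) by rewrite -c1 -exprS.
  rewrite c3 mulrDr mulr1 -expr2 -[X in X = _]addr0 => /addrI/esym cc0.
  have c0 : c = 0 by apply/eqP; move/eqP: cc0; rewrite expf_eq0.
  by have /eqP := c1; rewrite cc0 c0 addr0 eq_sym oner_eq0.
have cX i j : (i = j %[mod 3])%N -> c ^+ (3 ^ i) = c ^+ (3 ^ j).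
  have per k l : c ^+ (3 ^ (k * 3 + l)) = c ^+ (3 ^ l).
    elim: k => // k IHk; rewrite mulSn -addnA expnD exprM.
    by rewrite -[(3 ^ 3)%N]/27%N c27.
  by move=> eq_ij; rewrite (divn_eq i 3) (divn_eq j 3) !per eq_ij.
have Qshift i k : Q (c ^+ (3 ^ i)) = 0 -> Q (c ^+ (3 ^ (i + k * m))) = 0.
  move=> Qi; elim: k => [|k IHk]; first by rewrite addn0.
  by rewrite mulSnr addnA expnD exprM -Qq IHk expr0n expn_eq0.
have [i Qi] : exists i, Q (c ^+ (3 ^ i)) = 0.
  move/eqP: Q0; rewrite !mulf_eq0 -orbA => /or3P[] /eqP Qc; first by exists 0.
    by exists 1.
  by exists 2.
(* As m * m = 1 modulo 3, every residue modulo 3 is [i] plus a multiple of [m]. *)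
have Qall j : Q (c ^+ (3 ^ j)) = 0.
  have /= := Qshift i ((j + i.*2) * m)%N Qi; rewrite (@cX _ j) //.
  have mm : (m * m = 1 %[mod 3])%N.
    by rewrite -modnMm; move: m_mod3; case: (m %% 3)%N (ltn_mod m 3) => [|[|[]]].
  rewrite -mulnA (divn_eq (m * m) 3) mm mulnDr mulnA muln1 addnCA modnMDl.
  by rewrite addnCA -mul2n -mulSn mulnC addnC modnMDl.
(* Comparing two roots of the quadratic gives their sum, x y / u. *)
have diff j k : c ^+ (3 ^ j) <> c ^+ (3 ^ k) ->
    f x * f y = (c ^+ (3 ^ j) + c ^+ (3 ^ k)) * f u.
  move: (c ^+ (3 ^ j)) (c ^+ (3 ^ k)) (Qall j) (Qall k) => s t Qs Qt neq_st.
  have nz : s - t != 0 by rewrite subr_eq0; apply/eqP.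
  apply: (mulfI nz); apply/eqP; rewrite -subr_eq0; apply/eqP.
  transitivity (Q t - Q s); first by rewrite /Q; ring.
  by rewrite Qs Qt subrr.
have nfix2 : c <> c ^+ 9.
  by move=> c9; apply: nfix; rewrite {1}c9 -exprM.
have := diff 0 2 nfix2; rewrite (diff 0 1 (nesym nfix)).
move/mulIf => /(_ _) /addrI c39; apply: nfix.
rewrite -[RHS]c27 (exprM _ 9 3) -[c ^+ 9]/(c ^+ (3 ^ 2)) -c39 ?fmorph_eq0 //.
by rewrite -exprM c39 ?fmorph_eq0.
Qed.
End Injective.

(** * Ternary digit sums and carries *)

Section TernaryWeight.
Local Open Scope nat_scope.

Fixpoint ternary_weight (k j : nat) : nat :=
  if k is k'.+1 then j %% 3 + ternary_weight k' (j %/ 3) else 0.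

Lemma ternary_weight0 k : ternary_weight k 0 = 0.
Proof. by elim: k => //= k IHk; rewrite mod0n div0n IHk. Qed.

Lemma ternary_weight_max k j : ternary_weight k j <= k.*2.
Proof. by elim: k j => //= k IHk j; have := IHk (j %/ 3); lia. Qed.

(** Adding 7 j1 + 5 j2 + 3 j3 + j4 in base 3, with a sum whose digits are all 1,
    is a walk on the possible carries; a step that uses the digits a, b, d, e costs
    a + b + d + e - 1.  This table is the potential of the shortest paths in that
    graph, shifted to be nonnegative: it witnesses the absence of negative cycles. *)
Definition carry_potential (c : nat) : nat := nth 3 [:: 0; 1; 0; 1; 2; 1; 2] c.

Lemma carry_potential_step c c' a b d e :
    c <= 15 -> a < 3 -> b < 3 -> d < 3 -> e < 3 ->
    c + 7 * a + 5 * b + 3 * d + e = 3 * c' + 1 ->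
  c' <= 15 /\ carry_potential c' + 1 <= carry_potential c + (a + b + d + e).
Proof.
have tbl : all (fun c => all (fun a => all (fun b => all (fun d => all (fun e =>
    let n := c + 7 * a + 5 * b + 3 * d + e in (n %% 3 == 1) ==>
    (carry_potential (n %/ 3) + 1 <= carry_potential c + (a + b + d + e)))
    (iota 0 3)) (iota 0 3)) (iota 0 3)) (iota 0 3)) (iota 0 16) by vm_compute.
move=> lc la lb ld le Ecc'; split; first by lia.
have mem n k : n < k -> n \in iota 0 k by rewrite mem_iota.
have tc := allP tbl c (mem _ 16 lc).
have td := allP (allP (allP tc a (mem _ _ la)) b (mem _ _ lb)) d (mem _ _ ld).
have te := allP td e (mem _ _ le).
by move: te; rewrite /= Ecc' mulnC modnMDl divnMDl // addn0.
Qed.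

(** The digitwise addition telescopes the potential.  The equation says that
    c + 7 j1 + 5 j2 + 3 j3 + j4 equals (3^k - 1) / 2, the number with k digits 1,
    plus c' 3^k, where c and c' are the incoming and the outgoing carry. *)
Lemma carry_bound k c c' j1 j2 j3 j4 :
    c <= 15 -> j1 < 3 ^ k -> j2 < 3 ^ k -> j3 < 3 ^ k -> j4 < 3 ^ k ->
    2 * (c + 7 * j1 + 5 * j2 + 3 * j3 + j4) + 1 = (2 * c' + 1) * 3 ^ k ->
  carry_potential c' + k <= carry_potential c + (ternary_weight k j1
    + ternary_weight k j2 + ternary_weight k j3 + ternary_weight k j4).
Proof.
elim: k c j1 j2 j3 j4 => [|k IHk] c j1 j2 j3 j4 lc.
  rewrite expn0 !ltnS !leqn0 => /eqP-> /eqP-> /eqP-> /eqP-> ?.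
  by have -> : c' = c by lia.
rewrite expnSr => l1 l2 l3 l4; rewrite mulnA => Ec.
move: (_ * 3 ^ k) Ec (IHk) => P Ec IH.
pose c1 := (c + 7 * (j1 %% 3) + 5 * (j2 %% 3) + 3 * (j3 %% 3) + j4 %% 3) %/ 3.
have Ec1 : c + 7 * (j1 %% 3) + 5 * (j2 %% 3) + 3 * (j3 %% 3) + j4 %% 3
    = 3 * c1 + 1 by rewrite /c1; lia.
have [lc1 step] := carry_potential_step lc (ltn_pmod j1 (isT : 0 < 3))
  (ltn_pmod j2 (isT : 0 < 3)) (ltn_pmod j3 (isT : 0 < 3))
  (ltn_pmod j4 (isT : 0 < 3)) Ec1.
have : 2 * (c1 + 7 * (j1 %/ 3) + 5 * (j2 %/ 3) + 3 * (j3 %/ 3) + j4 %/ 3) + 1 = P.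
  by lia.
move/(IH c1 _ _ _ _ lc1); rewrite !ltn_divLR // => /(_ l1 l2 l3 l4) /=.
by move: step; lia.
Qed.

(** Modulo 3^m - 1 the addition is cyclic: the outgoing carry is also the
    incoming one, so that the potentials cancel and each of the m digits 1 of
    (3^m - 1) / 2 costs at least one unit of weight. *)
Lemma weight_bound m j1 j2 j3 j4 :
    j1 < 3 ^ m -> j2 < 3 ^ m -> j3 < 3 ^ m -> j4 < 3 ^ m ->
    (3 ^ m).-1 %| (3 ^ m)./2 + 7 * j1 + 5 * j2 + 3 * j3 + j4 ->
  m <= ternary_weight m j1 + ternary_weight m j2 + ternary_weight m j3
       + ternary_weight m j4.
Proof.
case: m => // m l1 l2 l3 l4 /dvdnP[t Et].
have oddq : odd (3 ^ m.+1) by rewrite oddX.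
have q3 : 2 < 3 ^ m.+1 by rewrite expnS; have := expn_gt0 3 m; lia.
move: (3 ^ m.+1) (@carry_bound m.+1 t.-1 t.-1 j1 j2 j3 j4) l1 l2 l3 l4 Et oddq q3.
move=> q IH l1 l2 l3 l4 Et oddq q3.
have t_gt0 : 0 < t by case: t Et {IH} => // Et; lia.
(* 7 + 5 + 3 + 1 = 16, which bounds the carry [t.-1] by 15. *)
have t_le : t <= 16 by nia.
have := IH _ l1 l2 l3 l4; rewrite leq_add2l; apply; first by lia.
nia.
Qed.
End TernaryWeight.

(** * Reduction of cyclotomic integers at a prime above 3 *)

(** Cyclotomic polynomials vanish at primitive roots of unity in every field:
    another factor of X^n - 1 would give the root a smaller order. *)
Lemma Cyclotomic_root (F : fieldType) (n : nat) (g : F) :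
  n.-primitive_root g -> root (map_poly intr 'Phi_n) g.
Proof.
move=> g_prim; have n_gt0 := prim_order_gt0 g_prim.
have dvd_unity d : d \in divisors n -> root (map_poly intr 'Phi_d) g -> g ^+ d = 1.
  rewrite -dvdn_divisors // => d_n Pg; have d_gt0 := dvdn_gt0 n_gt0 d_n.
  have Xd : map_poly intr (\prod_(e <- divisors d) 'Phi_e) = 'X^d - 1 :> {poly F}.
    by rewrite prod_Cyclotomic // rmorphB rmorph1 /= map_polyXn.
  apply/eqP; rewrite -subr_eq0; suff: root ('X^d - 1 : {poly F}) g.
    by rewrite rootE !hornerE.
  rewrite -Xd (big_rem d) ?divisors_id //= rmorphM rootM ?Pg //.
have : root (map_poly intr (\prod_(d <- divisors n) 'Phi_d)) g.
  rewrite prod_Cyclotomic // rmorphB rmorph1 /= map_polyXn.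
  by rewrite rootE !hornerE (prim_expr_order g_prim) subrr.
rewrite rmorph_prod /= big_seq.
elim/big_ind: _ => [|p1 p2 IH1 IH2|d d_n].
- by rewrite rootC oner_eq0.
- by rewrite rootM => /orP[].
move=> Pg; have gd := dvd_unity d d_n Pg; rewrite -dvdn_divisors // in d_n.
suff -> : n = d by [].
by apply/eqP; rewrite eqn_dvd d_n (prim_order_dvd g_prim) gd eqxx.
Qed.

(** Evaluation at [z] in the complex numbers determines evaluation at [g]: this
    is the ring morphism from Z[z] to F that sends z to g. *)
Lemma primitive_root_transfer (F : fieldType) (n : nat) (g : F) (z : algC)
    (p : {poly int}) :
    n.-primitive_root g -> n.-primitive_root z ->
  (map_poly intr p).[z] = 0 -> (map_poly intr p).[g] = 0.
Proof.
move=> g_prim z_prim pz0.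
have Q2C (r : {poly int}) : map_poly ratr (map_poly (intr : int -> rat) r)
    = map_poly intr r :> {poly algC}.
  by rewrite -map_poly_comp; apply: eq_map_poly => b; rewrite /= rmorph_int.
have [pf [Dpf mon_pf] dv_pf] := minCpolyP z.
have Epf : pf = map_poly intr 'Phi_n.
  apply: (@map_inj_poly _ _ (ratr : rat -> algC)).
  - exact: fmorph_inj.
  - by rewrite rmorph0.
  by rewrite -Dpf Q2C (minCpoly_cyclotomic z_prim) (Cintr_Cyclotomic z_prim).
have : 'Phi_n %| p.
  by rewrite -dvdp_rat_int -Epf -dv_pf Q2C rootE pz0.
move/dvdpP_int=> [r ->]; rewrite zprimitive_monic ?Cyclotomic_monic //.
by rewrite rmorphM hornerM (rootP (Cyclotomic_root g_prim)) mul0r.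
Qed.

Section IntEval.
Variables (R : comNzRingType) (t : R).
Local Notation ev p := (map_poly intr p).[t].

Let evB (a b : {poly int}) : ev (a - b) = ev a - ev b.
Proof. by rewrite rmorphB hornerD hornerN. Qed.

Let evD (a b : {poly int}) : ev (a + b) = ev a + ev b.
Proof. by rewrite rmorphD hornerD. Qed.

Let evM (a b : {poly int}) : ev (a * b) = ev a * ev b.
Proof. by rewrite rmorphM hornerM. Qed.

Let ev1 : ev 1 = 1.
Proof. by rewrite rmorph1 hornerC. Qed.

Let ev0 : ev 0 = 0.
Proof. by rewrite rmorph0 hornerC. Qed.

Let evX : ev 'X = t.
Proof. by rewrite map_polyX hornerX. Qed.

Definition evalE := (evB, evD, evM, ev1, ev0, evX).
End IntEval.

Section Residue.
Variables (F : fieldType) (F3 : 3%:R = 0 :> F) (n : nat) (g : F) (z w : algC).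
Hypotheses (g_prim : n.-primitive_root g) (z_prim : n.-primitive_root z).
Hypothesis w_cub : w ^+ 2 + w + 1 = 0.

Local Notation evC p := (map_poly intr p).[z].
Local Notation evF p := (map_poly intr p).[g].

(** The graph of the reduction morphism from the ring Z[z, w] to F, which sends z
    to g and the cube root of unity w to 1; its kernel is a prime above 3.
    Working with a relation avoids building the ring. *)
Definition residue (x : algC) (r : F) : Prop :=
  exists a b : {poly int}, x = evC a + evC b * w /\ r = evF a + evF b.

(** The reduction is well defined: if a + b w = 0 then the norm a^2 - a b + b^2,
    which involves z alone, vanishes, and it reduces to (a + b)^2. *)
Lemma residue_uniq0 r : residue 0 r -> r = 0.
Proof.
case=> a [b [x0 ->]]; pose N := a ^+ 2 - a * b + b ^+ 2.
have NC : evC N = 0.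
  transitivity (evC a ^+ 2 - evC a * evC b + evC b ^+ 2).
    by rewrite /N !(exprS, expr0, mulr1) !evalE.
  transitivity ((evC a + evC b * w) * (evC a - evC b - evC b * w)
                + evC b ^+ 2 * (w ^+ 2 + w + 1)); first by ring.
  by rewrite -x0 w_cub mul0r mulr0 addr0.
have := primitive_root_transfer g_prim z_prim NC.
rewrite /N !(exprS, expr0, mulr1) !evalE => NF.
apply/eqP; have := expf_eq0 (evF a + evF b) 2; rewrite /= => <-; apply/eqP.
rewrite -[RHS]NF -[RHS]addr0 -(mul0r (evF a * evF b)) -F3.
by ring.
Qed.

Lemma residueB x r y s : residue x r -> residue y s -> residue (x - y) (r - s).
Proof.
case=> a [b [-> ->]] [c [d [-> ->]]]; exists (a - c), (b - d).
by split; rewrite !evalE; ring.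
Qed.

Lemma residueM x r y s : residue x r -> residue y s -> residue (x * y) (r * s).
Proof.
case=> a [b [-> ->]] [c [d [-> ->]]].
exists (a * c - b * d), (a * d + b * c - b * d).
rewrite !evalE.
split; apply/eqP; rewrite -subr_eq0; apply/eqP.
  by rewrite -(mulr0 (evC b * evC d)) -w_cub; ring.
by rewrite -(mulr0 (evF b * evF d)) -F3; ring.
Qed.

Lemma residue1 : residue 1 1.
Proof.
by exists 1, 0; rewrite !evalE mul0r !addr0.
Qed.

Lemma residue_w : residue w 1.
Proof.
by exists 0, 1; rewrite !evalE mul1r !add0r.
Qed.

Lemma residue_z : residue z g.
Proof.
exists 'X, 0; rewrite !evalE.
by rewrite mul0r !addr0.
Qed.

Lemma residue0 : residue 0 0.
Proof.
rewrite -(subrr 1) -[X in residue _ X](subrr 1).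
exact/residueB/residue1/residue1.
Qed.

Lemma residueN x r : residue x r -> residue (- x) (- r).
Proof. by rewrite -(sub0r x) -(sub0r r); apply/residueB/residue0. Qed.

Lemma residueD x r y s : residue x r -> residue y s -> residue (x + y) (r + s).
Proof. by move=> xr ys; rewrite -(opprK y) -(opprK s); apply/residueB/residueN. Qed.

Lemma residueX x r k : residue x r -> residue (x ^+ k) (r ^+ k).
Proof.
move=> xr; elim: k => [|k IHk]; first exact: residue1.
by rewrite !exprS; apply: residueM.
Qed.

Lemma residue_nat k : residue k%:R k%:R.
Proof.
elim: k => [|k IHk]; first exact: residue0.
by rewrite -!natr1; apply: residueD => //; apply: residue1.
Qed.

Lemma residue_sum (I : Type) (s : seq I) (P : pred I) (x : I -> algC) (r : I -> F) :
  (forall i, P i -> residue (x i) (r i)) ->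
  residue (\sum_(i <- s | P i) x i) (\sum_(i <- s | P i) r i).
Proof.
by move=> xr; elim/big_ind2: _ => // [|*]; [exact: residue0 | exact: residueD].
Qed.

Lemma residue_uniq x r s : residue x r -> residue x s -> r = s.
Proof.
move=> xr xs; apply/eqP; rewrite -subr_eq0; apply/eqP.
by apply: residue_uniq0; rewrite -(subrr x); apply: residueB.
Qed.

(** The valuation of [x] at the prime of [residue] is at least [k], in units of the
    uniformizer 1 - w; a denominator [c] prime to that prime is allowed, since there
    may be other primes above 3 at which [x] is not divisible. *)
Definition valuation_ge (k : nat) (x : algC) : Prop :=
  exists c r y s, [/\ residue c r, r != 0, residue y s & c * x = (1 - w) ^+ k * y].

Lemma residue_pi : residue (1 - w) 0.
Proof.
by rewrite -(subrr 1); apply: residueB; [exact: residue1 | exact: residue_w].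
Qed.

Lemma valuation_ge_residue x r : residue x r -> valuation_ge 0 x.
Proof.
by exists 1, 1, x, r; rewrite oner_neq0 !mul1r; split=> //; exact: residue1.
Qed.

Lemma valuation_ge0 k : valuation_ge k 0.
Proof.
exists 1, 1, 0, 0; rewrite oner_neq0 !mulr0.
by split=> //; [exact: residue1 | exact: residue0].
Qed.

Lemma valuation_geM k l x y :
  valuation_ge k x -> valuation_ge l y -> valuation_ge (k + l) (x * y).
Proof.
case=> c [r [x' [s [cr r0 xs Ex]]]] [d [t [y' [v [dt t0 yv Ey]]]]].
exists (c * d), (r * t), (x' * y'), (s * v); split.
- exact: residueM.
- by rewrite mulf_neq0.
- exact: residueM.
by rewrite mulrACA Ex Ey exprD mulrACA.
Qed.

Lemma valuation_geD k x y :
  valuation_ge k x -> valuation_ge k y -> valuation_ge k (x + y).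
Proof.
case=> c [r [x' [s [cr r0 xs Ex]]]] [d [t [y' [v [dt t0 yv Ey]]]]].
exists (c * d), (r * t), (d * x' + c * y'), (t * s + r * v); split.
- exact: residueM.
- by rewrite mulf_neq0.
- by apply: residueD; apply: residueM.
transitivity (d * (c * x) + c * (d * y)); first by ring.
by rewrite Ex Ey; ring.
Qed.

Lemma valuation_ge_sum k (I : Type) (s : seq I) (P : pred I) (x : I -> algC) :
  (forall i, P i -> valuation_ge k (x i)) ->
  valuation_ge k (\sum_(i <- s | P i) x i).
Proof.
move=> kx; elim/big_ind: _ => //; first exact: valuation_ge0.
exact: valuation_geD.
Qed.

Lemma valuation_ge_leq k l x : (l <= k)%N -> valuation_ge k x -> valuation_ge l x.
Proof.
move=> lk [c [r [y [s [cr r0 ys Ex]]]]].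
exists c, r, ((1 - w) ^+ (k - l) * y), (0 ^+ (k - l) * s).
by rewrite mulrA -exprD subnKC //; split=> //; apply/residueM/ys/residueX/residue_pi.
Qed.

Lemma valuation_ge_unit k c r x :
  residue c r -> r != 0 -> valuation_ge k (c * x) -> valuation_ge k x.
Proof.
move=> cr r0 [d [t [y [s [dt t0 ys Ex]]]]].
exists (d * c), (t * r), y, s; rewrite -mulrA; split=> //.
  exact: residueM.
by rewrite mulf_neq0.
Qed.

Lemma valuation_ge_pi x r : residue x r -> valuation_ge 1 ((1 - w) * x).
Proof.
by exists 1, 1, x, r; rewrite oner_neq0 !mul1r expr1; split=> //; exact: residue1.
Qed.

Lemma w_cube : w ^+ 3 = 1.
Proof.
apply/eqP; rewrite -subr_eq0; apply/eqP.
by rewrite -(mulr0 (w - 1)) -w_cub; ring.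
Qed.

Lemma sqr_pi : (1 - w) ^+ 2 = - (3%:R * w).
Proof.
apply/eqP; rewrite -subr_eq0; apply/eqP.
by rewrite -w_cub; ring.
Qed.

Lemma valuation_ge_3X k : valuation_ge k.*2 (3 ^ k)%:R.
Proof.
elim: k => [|k IHk]; first exact/valuation_ge_residue/residue1.
rewrite expnS natrM doubleS -add2n; apply: valuation_geM => //.
exists w, 1, (-1), (-1); rewrite oner_neq0; split=> //; first exact: residue_w.
  exact/residueN/residue1.
by rewrite sqr_pi; ring.
Qed.

Lemma pi_neq0 : 1 - w != 0.
Proof.
apply/eqP => /(congr1 (fun t => t ^+ 2)); rewrite sqr_pi expr0n /= => /eqP.
rewrite oppr_eq0 mulf_eq0 pnatr_eq0 /= => /eqP w0.
by move/eqP: w_cub; rewrite w0 expr0n !add0r oner_eq0.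
Qed.

Lemma residue_int (M : int) : residue M%:~R M%:~R.
Proof.
by case: M => k; rewrite ?NegzE ?mulrNz; [|apply: residueN]; exact: residue_nat.
Qed.

(** Divisibility of a rational integer at one prime above 3 is divisibility
    by 3. *)
Lemma residue_dvd3 e c r (M : int) y s :
    residue c r -> r != 0 -> residue y s -> c * M%:~R = (3 ^ e)%:R * y ->
  (3 ^ e %| `|M|)%N.
Proof.
move=> cr r0; elim: e M y s => [|e IHe] M y s ys Ec; first by rewrite expn0 dvd1n.
have M0 : M%:~R = 0 :> F.
  apply: (mulfI r0); rewrite mulr0; apply: (residue_uniq (x := c * M%:~R)).
    by apply: residueM => //; exact: residue_int.
  rewrite Ec expnS natrM -(mul0r ((3 ^ e)%:R * s)) -F3 -mulrA.
  by do !apply: residueM => //; exact: residue_nat.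
have : (3 %| `|M|)%N.
  have M0' : `|M|%N%:R = 0 :> F.
    case: (M) M0 => k; rewrite ?NegzE ?mulrNz // => /eqP.
    by rewrite oppr_eq0 => /eqP.
  have ch3 : 3%N \in [pchar F] by rewrite inE /= F3 eqxx.
  by rewrite (dvdn_pcharf ch3) M0' eqxx.
case/dvdnP=> k Mk; rewrite Mk expnSr dvdn_pmul2r //.
have [M' EM kM] : exists2 M' : int, M = M' * 3 & k = `|M'|%N.
  have : (3 %| M)%Z by rewrite dvdzE Mk dvdn_mull.
  by case/dvdzP=> M' EM; exists M' => //; move: Mk; rewrite EM abszM; lia.
rewrite kM; apply: (IHe M' y s ys).
have nz3 : 3%:R != 0 :> algC by rewrite pnatr_eq0.
apply: (mulIf nz3); move: Ec; rewrite EM expnS natrM rmorphM /= => Ec.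
by rewrite -mulrA Ec; ring.
Qed.

(** As w - w^2 has valuation 1, the integer has valuation 2 e, and 3 has
    valuation 2. *)
Lemma valuation_ge_dvd3 e (M : int) :
  valuation_ge e.*2.+1 (M%:~R * (w - w ^+ 2)) -> (3 ^ e %| `|M|)%N.
Proof.
case=> c [r [y [s [cr r0 ys Ec]]]].
apply: (@residue_dvd3 e (c * w) (r * 1) M ((- w) ^+ e * y) ((- 1) ^+ e * s)).
- by apply: residueM => //; exact: residue_w.
- by rewrite mulr1.
- by apply: residueM => //; apply/residueX/residueN/residue_w.
(* (1 - w)^2 = - 3 w explains the factor (- w)^e. *)
apply: (mulfI pi_neq0).
transitivity (c * (M%:~R * (w - w ^+ 2))); first by ring.
rewrite Ec exprS -mul2n exprM sqr_pi -mulrN exprMn natrX; ring.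
Qed.

End Residue.

(** * The trace and the additive character *)

Section Trace.
Variables (m : nat) (F : finFieldType).
Hypotheses (m_gt0 : (0 < m)%N) (cardF : #|F| = (3 ^ m)%N) (F3 : 3%:R = 0 :> F).

(** The trace from F to its prime field F_3, with values in F. *)
Definition tr3 (y : F) : F := \sum_(i < m) y ^+ (3 ^ i).

Lemma tr3D x y : tr3 (x + y) = tr3 x + tr3 y.
Proof. by rewrite -big_split; apply: eq_bigr => i _; exact: exp3XD_char3. Qed.

Lemma tr3_0 : tr3 0 = 0.
Proof. by apply: (addIr (tr3 0)); rewrite -tr3D !add0r. Qed.

Lemma tr3N x : tr3 (- x) = - tr3 x.
Proof. by apply: (addIr (tr3 x)); rewrite -tr3D !addNr tr3_0. Qed.

Lemma tr3_cube y : tr3 (y ^+ 3) = tr3 y.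
Proof.
rewrite /tr3 -(prednK m_gt0) big_ord_recr big_ord_recl /= addrC expr1.
rewrite -exprM -expnS prednK // -cardF expf_card; congr (_ + _).
by apply: eq_bigr => i _; rewrite -exprM -expnS.
Qed.

Lemma cube_tr3 y : tr3 y ^+ 3 = tr3 y.
Proof.
rewrite -[RHS]tr3_cube /tr3.
have : (tr3 y) ^+ 3 = \sum_(i < m) (y ^+ (3 ^ i)) ^+ 3.
  rewrite /tr3; elim/big_rec2: _ => [|i s t _ IH]; first by rewrite expr0n.
  by rewrite cubeD_char3 // IH.
by rewrite /tr3 => ->; apply: eq_bigr => i _; rewrite exprAC.
Qed.

Lemma cube_fixed (t : F) : t ^+ 3 = t -> [|| t == 0, t == 1 | t == -1].
Proof.
move=> t3; have : t * ((t - 1) * (t + 1)) = 0.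
  by transitivity (t ^+ 3 - t); [ring | rewrite t3 subrr].
by move/eqP; rewrite !mulf_eq0 subr_eq0 addr_eq0.
Qed.

Lemma tr3_val y : [|| tr3 y == 0, tr3 y == 1 | tr3 y == -1].
Proof. exact/cube_fixed/cube_tr3. Qed.

(** The trace is a nonzero polynomial of degree less than #|F|. *)
Lemma tr3_onto : exists y, tr3 y = 1.
Proof.
have [y ty0] : exists y, tr3 y != 0.
  apply/existsP; apply: contraT; rewrite negb_exists => /forallP t0.
  pose p : {poly F} := \sum_(i < m) 'X^(3 ^ i).
  have p0 : p = 0.
    apply/eqP; apply: contraT => nzp.
    have rp : all (root p) (enum F).
      apply/allP => y _; rewrite rootE horner_sum; apply/eqP.
      have := t0 y; rewrite negbK => /eqP; rewrite /tr3 => {2}<-.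
      by apply: eq_bigr => i _; rewrite hornerXn.
    have := max_poly_roots nzp rp (enum_uniq F).
    rewrite -cardE cardF ltnNge => /negP[].
    apply: leq_trans (size_sum _ _ _) _; apply/bigmax_leqP => i _.
    by rewrite size_polyXn ltn_exp2l.
  have := congr1 (fun r : {poly F} => r`_1) p0.
  rewrite /p coef_sum coef0 -(prednK m_gt0) big_ord_recl /= expn0 coefXn eqxx.
  rewrite big1 ?addr0 => [/eqP|i _]; first by rewrite oner_eq0.
  rewrite coefXn /bump /= expnS; case: eqP => // e3; have := expn_gt0 3 i; lia.
case/or3P: (tr3_val y) ty0 => /eqP ty; rewrite ty ?eqxx // => _; first by exists y.
by exists (- y); rewrite tr3N ty opprK.
Qed.

Variable w : algC.
Hypothesis w_cub : w ^+ 2 + w + 1 = 0.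

(** The additive character w^(Tr y). *)
Definition psi (y : F) : algC :=
  if tr3 y == 0 then 1 else if tr3 y == 1 then w else w ^+ 2.

Lemma one_neqN1 : 1 != -1 :> F.
Proof.
apply/eqP => e; have /eqP[] := oner_neq0 F.
transitivity (3%:R - (1 - -1) : F); first by ring.
by rewrite F3 -e subrr subr0.
Qed.

Lemma psi0 y : tr3 y = 0 -> psi y = 1.
Proof. by rewrite /psi => ->; rewrite eqxx. Qed.

Lemma psi1 y : tr3 y = 1 -> psi y = w.
Proof. by rewrite /psi => ->; rewrite oner_eq0 eqxx. Qed.

Lemma psiD x y : psi (x + y) = psi x * psi y.
Proof.
have w3 := w_cube w_cub.
have N1 : 1 + 1 = -1 :> F.
  by apply/eqP; rewrite -subr_eq0 opprK -F3; apply/eqP; ring.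
have N2 : -1 + -1 = 1 :> F by rewrite -opprD N1 opprK.
have w4 : w ^+ 2 * w ^+ 2 = w by rewrite -exprD (exprD w 3 1) w3 mul1r.
have cE := tr3D x y.
have psiE t c : tr3 t = c ->
    psi t = if c == 0 then 1 else if c == 1 then w else w ^+ 2 by move=> <-.
have e1 : (1 == 0 :> F) = false by exact: oner_eq0.
have eN : (-1 == 0 :> F) = false by rewrite oppr_eq0.
have eN1 : (-1 == 1 :> F) = false by rewrite eq_sym (negbTE one_neqN1).
rewrite (psiE _ _ cE) (psiE _ _ erefl) (psiE y _ erefl).
case/or3P: (tr3_val x) => /eqP->; case/or3P: (tr3_val y) => /eqP->;
  rewrite ?N1 ?N2 ?addr0 ?add0r ?subrr ?addNr ?eqxx ?e1 ?eN ?eN1 ?eqxx;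
  by rewrite ?mul1r ?mulr1 ?w4 // -?exprS -?exprSr ?w3.
Qed.

Lemma psi_0 : psi 0 = 1.
Proof. by rewrite psi0 ?tr3_0. Qed.

Lemma psi_cube y : psi (y ^+ 3) = psi y.
Proof. by rewrite /psi tr3_cube. Qed.

Lemma w_neq1 : w != 1.
Proof. by have := pi_neq0 w_cub; rewrite subr_eq0 eq_sym. Qed.

Lemma sum_psi : \sum_y psi y = 0.
Proof.
have [y0 ty0] := tr3_onto.
have nz : psi y0 - 1 != 0 by rewrite subr_eq0 (psi1 ty0) w_neq1.
apply: (mulfI nz); rewrite mulr0 mulrBl mul1r mulr_sumr.
rewrite [X in _ - X](reindex_inj (addrI y0)) /=; apply/eqP; rewrite subr_eq0.
by apply/eqP/eq_bigr => y _; rewrite psiD.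
Qed.

Lemma sum_psiM b : \sum_y psi (b * y) = if b == 0 then (3 ^ m)%:R else 0.
Proof.
case: eqP => [->|/eqP b0].
  rewrite (eq_bigr (fun=> 1)) => [|y _]; last by rewrite mul0r psi_0.
  by rewrite sumr_const -cardF.
by rewrite -[RHS]sum_psi [RHS](reindex_inj (mulfI b0)).
Qed.

(** The three fibres of the trace are translates of each other, so three times
    this cardinal is #|F|, which is odd. *)
Lemma card_tr3 : odd #|[set y | tr3 y == 1]|.
Proof.
have [y0 ty0] := tr3_onto.
pose N c := #|[set y | tr3 y == c]|.
have shift c : N (c + 1) = N c.
  rewrite /N -[RHS](card_imset _ (addrI y0)); congr #|pred_of_set _|.
  apply/setP => y; rewrite inE; apply/idP/imsetP => [/eqP ty|[x]]; last first.
    by rewrite inE => /eqP <- ->; rewrite tr3D ty0 addrC.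
  by exists (y - y0); [rewrite inE tr3D tr3N ty ty0 addrK | rewrite addrC subrK].
have N01 : N 1 = N 0 by rewrite -(shift 0) add0r.
have Nm1 : N (-1) = N 0 by rewrite -(shift (-1)) addNr.
have tot : #|F| = (N 0%R + N 1%R + N (-1)%R)%N.
  rewrite -cardsT /N -(cardsUI [set y | tr3 y == 0]).
  rewrite (_ : _ :&: _ = set0) ?cards0 ?addn0; last first.
    by apply/setP => y; rewrite !inE; case: eqP => // ->; rewrite eq_sym oner_eq0.
  rewrite -cardsUI (_ : _ :&: _ = set0) ?cards0 ?addn0; last first.
    apply/setP => y; rewrite !inE.
    case: (tr3 y =P -1) => [->|]; last by rewrite andbF.
    by rewrite oppr_eq0 oner_eq0 eq_sym (negbTE one_neqN1).
  by apply: eq_card => y; rewrite !inE -orbA tr3_val.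
have : odd #|F| by rewrite cardF oddX orbT.
by rewrite tot -/(N 1) Nm1 N01 !oddD addbb addFb.
Qed.
End Trace.

(** * Gauss sums and their valuations *)

Section PowersOfThree.
Variable m : nat.
Local Notation q := (3 ^ m)%N.

Lemma exp3_gt2 : (0 < m)%N -> (2 < q)%N.
Proof.
by move=> m_gt0; rewrite -{1}(prednK m_gt0) expnS; have := expn_gt0 3 m.-1; lia.
Qed.

Lemma pred_exp3_gt0 : (0 < m)%N -> (0 < q.-1)%N.
Proof. by move/exp3_gt2; lia. Qed.

Lemma half_exp3 : (q./2.*2 = q.-1)%N.
Proof. by have := odd_double_half q; rewrite oddX orbT; lia. Qed.

Lemma odd_half_exp3 : odd m -> odd q./2.
Proof.
move=> m_odd; have : (q %% 4 = 3)%N; last first.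
  move: (3 ^ m)%N => n n3; have := odd_double_half n; have := odd_double_half n./2.
  by case: (odd n./2) => //; lia.
rewrite -(odd_double_half m) m_odd add1n; elim: m./2 => // k IHk.
by rewrite doubleS 2!expnS; move: (3 ^ _)%N IHk => n; lia.
Qed.
End PowersOfThree.

Section Gauss.
Variables (m : nat) (F : finFieldType).
Hypotheses (m_gt0 : (0 < m)%N) (cardF : #|F| = (3 ^ m)%N) (F3 : 3%:R = 0 :> F).
Local Notation q := (3 ^ m)%N.
Variables (g : F) (z w : algC).
Hypotheses (g_prim : q.-1.-primitive_root g) (z_prim : q.-1.-primitive_root z).
Hypothesis w_cub : w ^+ 2 + w + 1 = 0.

Local Notation residue := (residue g z w).
Local Notation valuation_ge := (valuation_ge g z w).
Local Notation psi := (@psi m F w).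

Let resM x r y s := @residueM F F3 g z w w_cub x r y s.
Let resX x r k := @residueX F F3 g z w w_cub x r k.
Let valM k l x y := @valuation_geM F F3 g z w w_cub k l x y.
Let val_unit k c r x := @valuation_ge_unit F F3 g z w w_cub k c r x.
Let val_leq k l x := @valuation_ge_leq F F3 g z w w_cub k l x.
Let val_sum k I s P x := @valuation_ge_sum F F3 g z w w_cub k I s P x.

Let q_gt2 : (2 < q)%N. Proof. exact: exp3_gt2. Qed.
Let q1_gt0 : (0 < q.-1)%N. Proof. exact: pred_exp3_gt0. Qed.
Let qE : q = q.-1.+1. Proof. by rewrite prednK ?expn_gt0. Qed.

Lemma expf_q1 (x : F) : x != 0 -> x ^+ q.-1 = 1.
Proof.
move=> x0; apply: (mulfI x0); rewrite mulr1 -exprS prednK ?expn_gt0 //.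
by rewrite -cardF expf_card.
Qed.

Lemma dlog x : x != 0 -> exists k, x = g ^+ k.
Proof. by move=> x0; have [k ->] := prim_rootP g_prim (expf_q1 x0); exists k. Qed.

Lemma g_neq0 k : g ^+ k != 0.
Proof.
apply/expf_neq0/eqP => g0; have /eqP := prim_expr_order g_prim.
by rewrite g0 expr0n eqn0Ngt q1_gt0 eq_sym oner_eq0.
Qed.

(** The multiplicative character with chi(g) = z and chi(0) = 0: at most one
    index contributes to the sum. *)
Definition chi (x : F) : algC := \sum_(i < q.-1 | g ^+ i == x) z ^+ i.

Lemma chi_g k : chi (g ^+ k) = z ^+ k.
Proof.
pose i0 : 'I_q.-1 := Ordinal (ltn_pmod k q1_gt0).
rewrite /chi (big_pred1 i0) /= => [|i]; first exact: prim_expr_mod.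
by rewrite (eq_prim_root_expr g_prim) modn_small.
Qed.

Lemma chi0 : chi 0 = 0.
Proof. by rewrite /chi big_pred0 // => i; rewrite (negbTE (g_neq0 _)). Qed.

Lemma chi1 : chi 1 = 1.
Proof. exact: (chi_g 0). Qed.

Lemma chiM x y : chi (x * y) = chi x * chi y.
Proof.
have [->|x0] := eqVneq x 0; first by rewrite mul0r chi0 mul0r.
have [->|y0] := eqVneq y 0; first by rewrite mulr0 chi0 mulr0.
have [[i ->] [j ->]] := (dlog x0, dlog y0).
by rewrite -exprD !chi_g exprD.
Qed.

Lemma chiX x k : chi (x ^+ k) = chi x ^+ k.
Proof. by elim: k => [|k IHk]; rewrite ?chi1 // !exprS chiM IHk. Qed.

(** [chi] is the Teichmueller lift for the reduction [residue]. *)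
Lemma residue_chi x : residue (chi x) x.
Proof.
have [->|x0] := eqVneq x 0; first by rewrite chi0; exact: residue0.
by have [k ->] := dlog x0; rewrite chi_g; apply/resX/residue_z.
Qed.

Lemma chi_q1 x : x != 0 -> chi x ^+ q.-1 = 1.
Proof. by move=> x0; rewrite -chiX expf_q1 // chi1. Qed.

Lemma chi_eqmod x j k : (0 < j)%N -> (0 < k)%N -> (j = k %[mod q.-1])%N ->
  chi x ^+ j = chi x ^+ k.
Proof.
move=> j0 k0 jk; have [->|x0] := eqVneq x 0.
  by rewrite chi0 !expr0n !eqn0Ngt j0 k0.
by rewrite -(expr_mod j (chi_q1 x0)) jk (expr_mod k (chi_q1 x0)).
Qed.

Lemma sum_chi0 k : ~~ (q.-1 %| k)%N -> \sum_x chi x ^+ k = 0.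
Proof.
move=> nk; have nz : z ^+ k - 1 != 0 by rewrite subr_eq0 -(prim_order_dvd z_prim).
apply: (mulfI nz); rewrite mulr0 mulrBl mul1r mulr_sumr; apply/eqP.
have g0 : g != 0 by exact: (g_neq0 1).
rewrite subr_eq0 [X in _ == X](reindex_inj (mulfI g0)) /=; apply/eqP/eq_bigr => x _.
by rewrite chiM (chi_g 1) exprMn.
Qed.

Lemma sum_chi_dvd k : (0 < k)%N -> (q.-1 %| k)%N -> \sum_x chi x ^+ k = (q.-1)%:R.
Proof.
move=> k0 /dvdnP[l kl]; rewrite (bigD1 0) //= chi0 expr0n eqn0Ngt k0 add0r.
rewrite (eq_bigr (fun=> 1)) => [|x x0]; last first.
  by rewrite kl mulnC exprM chi_q1 // expr1n.
by rewrite sumr_const (cardC1 0) cardF.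
Qed.

Lemma sum_pow k : (k < q.-1)%N -> \sum_(x : F) x ^+ k = 0.
Proof.
case: k => [_|k lt_k].
  rewrite (eq_bigr (fun=> 1)) => [|x _]; last by rewrite expr0.
  rewrite sumr_const cardF natrX F3 expr0n.
  by rewrite eqn0Ngt m_gt0.
apply: (residue_uniq0 F3 g_prim z_prim w_cub).
rewrite -(@sum_chi0 k.+1) ?gtnNdvd //.
by apply: residue_sum => x _; exact/resX/residue_chi.
Qed.

(** The Gauss sum of the character chi^-j; the exponent is written as a positive
    one so that the term at 0 vanishes. *)
Definition gauss (j : nat) : algC := \sum_x psi x * chi x ^+ (q.-1 - j).

Lemma residue_psi x : residue (psi x) 1.
Proof.
rewrite /psi; case: ifP => _; first exact: residue1.
case: ifP => _; first exact: residue_w.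
rewrite -(expr1n _ 2); exact/resX/residue_w.
Qed.

Lemma psi_sub1 x : exists y r, residue y r /\ psi x - 1 = (1 - w) * y.
Proof.
rewrite /psi; case: ifP => _.
  by exists 0, 0; rewrite subrr mulr0; split=> //; exact: residue0.
case: ifP => _.
  by exists (- 1), (- 1); split; [exact/residueN/residue1 | ring].
exists (- 1 - w), (- 1 - 1); split; last by ring.
by apply: residueB; [exact/residueN/residue1 | exact: residue_w].
Qed.

Lemma residue_gauss j : exists r, residue (gauss j) r.
Proof.
exists (\sum_x 1 * x ^+ (q.-1 - j)); apply: residue_sum => x _.
by apply: resM => //; [exact: residue_psi | apply/resX/residue_chi].
Qed.

(** All values of [psi] are congruent to 1 modulo 1 - w, and the values of a
    nontrivial multiplicative character sum to 0. *)
Lemma gauss1_valuation : valuation_ge 1 (gauss 1).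
Proof.
have -> : gauss 1 = \sum_x (psi x - 1) * chi x ^+ (q.-1 - 1).
  under [RHS]eq_bigr do rewrite mulrBl mul1r.
  rewrite sumrB [X in _ - X]sum_chi0 ?subr0 // gtnNdvd //; have := q_gt2; lia.
apply: val_sum => x _; have [y [r [ry ->]]] := psi_sub1 x.
rewrite -mulrA; apply: valuation_ge_pi; apply: resM ry _.
exact/resX/residue_chi.
Qed.

Lemma cube_bij : bijective (fun x : F => x ^+ 3).
Proof.
apply: injF_bij => x y /= exy; apply/eqP; rewrite -subr_eq0.
have := expf_eq0 (x - y) 3; rewrite /= => <-; apply/eqP.
rewrite cubeD_char3 // exy exprNn; ring.
Qed.

(** The trace, hence [psi], is invariant under cubing. *)
Lemma gauss_frob j : (j * 3 < q.-1)%N -> gauss (j * 3) = gauss j.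
Proof.
move=> lt_j; rewrite /gauss [RHS](reindex _ (onW_bij _ cube_bij)).
apply: eq_bigr => x _; rewrite psi_cube // chiX -exprM; congr (_ * _).
apply: chi_eqmod; [lia | lia |].
have -> : (3 * (q.-1 - j) = 2 * q.-1 + (q.-1 - j * 3))%N by lia.
by rewrite modnMDl.
Qed.

Definition jacobi (a b : nat) : algC := \sum_x chi x ^+ a * chi (1 - x) ^+ b.

Lemma gauss_jacobi j : (0 < j)%N -> (j < q.-1)%N ->
  gauss j.-1 * gauss 1 = jacobi (q.-1 - j.-1) (q.-1 - 1) * gauss j.
Proof.
move=> j0 lt_j; set a := (q.-1 - j.-1)%N; set b := (q.-1 - 1)%N.
have a0 : (0 < a)%N by rewrite /a; lia.
have b0 : (0 < b)%N by rewrite /b; have := q_gt2; lia.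
transitivity (\sum_t psi t * \sum_x chi x ^+ a * chi (t - x) ^+ b).
  rewrite /gauss -/a -/b mulr_suml.
  under [RHS]eq_bigr do rewrite mulr_sumr.
  rewrite exchange_big /=; apply: eq_bigr => x _.
  rewrite [RHS](reindex_inj (addrI x)) mulr_sumr; apply: eq_bigr => y _ /=.
  by rewrite [x + y]addrC addrK psiD //; ring.
rewrite (bigD1 0) //= [X in _ * X](_ : _ = 0) ?mulr0 ?add0r; last first.
  transitivity (chi (-1) ^+ b * \sum_x chi x ^+ (a + b)).
    rewrite mulr_sumr; apply: eq_bigr => x _.
    by rewrite sub0r -(mulN1r x) chiM exprMn exprD mulrCA.
  rewrite sum_chi0 ?mulr0 //.
  have -> : (a + b = q.-1 + (q.-1 - j))%N by rewrite /a /b; lia.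
  by rewrite (dvdn_addr _ (dvdnn _)) gtnNdvd //; lia.
rewrite /gauss [X in _ * X](bigD1 0) //= chi0 expr0n subn_eq0 leqNgt lt_j.
rewrite mulr0 add0r mulr_sumr; apply: eq_bigr => t t0.
rewrite mulrCA; congr (_ * _); rewrite (reindex_inj (mulfI t0)) /= mulr_suml.
apply: eq_bigr => x _.
have -> : t - t * x = t * (1 - x) by ring.
rewrite !chiM !exprMn mulrACA -exprD mulrC; congr (_ * _).
apply: chi_eqmod; [lia | lia |].
have -> : (a + b = 1 * q.-1 + (q.-1 - j))%N by rewrite /a /b; lia.
by rewrite modnMDl.
Qed.

(** Reducing to F and inverting the summation variable, the Jacobi sum becomes
    the sum of x^j / (x - 1) over x <> 1, that is, of the geometric sums
    1 + x + ... + x^(j-1), each power of x contributing -1. *)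
Lemma jacobi_residue j : (0 < j)%N -> (j < q.-1)%N ->
  residue (jacobi (q.-1 - j.-1) (q.-1 - 1)) (- j%:R).
Proof.
move=> j0 lt_j.
have : residue (jacobi (q.-1 - j.-1) (q.-1 - 1))
    (\sum_x x ^+ (q.-1 - j.-1) * (1 - x) ^+ (q.-1 - 1)).
  by apply: residue_sum => x _; apply: resM => //;
     apply/resX/residue_chi.
congr (residue _ _).
have expV (x : F) k : (k <= q.-1)%N -> x != 0 -> x ^+ (q.-1 - k) = x^-1 ^+ k.
  move=> le_k x0; rewrite exprVn; apply: (mulIf (expf_neq0 k x0)).
  by rewrite -exprD subnK // expf_q1 // mulVf // expf_neq0.
transitivity (\sum_(x : F | x != 1) x ^+ j / (x - 1)).
  rewrite (bigD1 0) //= expr0n subn_eq0 leqNgt (_ : (j.-1 < q.-1)%N); last by lia.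
  rewrite mul0r add0r (bigD1 1) ?oner_neq0 //= subrr expr0n subn_eq0 leqNgt.
  rewrite (_ : (1 < q.-1)%N); last by have := q_gt2; lia.
  rewrite mulr0 add0r.
  rewrite [RHS](bigD1 0) ?(eq_sym 0) ?oner_neq0 //= expr0n eqn0Ngt j0 mul0r add0r.
  rewrite (reindex_inj invr_inj) /=; apply: eq_big => x.
    by rewrite invr_eq0 invr_eq1 andbC.
  case/andP=> x0 x1; rewrite invr_eq0 in x0; rewrite invr_eq1 in x1.
  rewrite expV ?invr_eq0 // ?expV ?subr_eq0 1?eq_sym ?invr_eq1 //; try lia.
  rewrite invrK expr1 -{2}(prednK j0) exprSr.
  rewrite -mulrA; congr (_ * _).
  have x1' : x - 1 != 0 by rewrite subr_eq0.
  by field; rewrite x0 x1'.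
transitivity (\sum_(x : F | x != 1) (\sum_(i < j) x ^+ i + (x - 1)^-1)).
  apply: eq_bigr => x x1; have x1' : x - 1 != 0 by rewrite subr_eq0.
  apply: (mulIf x1'); rewrite mulrDl mulVf // divfK //.
  by rewrite mulrC -subrX1 subrK.
rewrite big_split /= exchange_big /=.
rewrite [X in _ + X](_ : _ = 0) ?addr0; last first.
  rewrite (reindex_inj (addrI 1)) /= (eq_bigl (fun x => x != 0)) => [|x]; last first.
    by rewrite -subr_eq0 addrC addKr.
  rewrite (eq_bigr (fun x => x^-1)) => [|x _]; last by rewrite addrC addKr.
  rewrite (reindex_inj invr_inj) /= (eq_bigr id) => [|x _]; last by rewrite invrK.
  transitivity (\sum_(x : F) x ^+ 1); last first.
    by apply: sum_pow; have := q_gt2; lia.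
  by rewrite [RHS](bigD1 0) //= add0r; apply: eq_bigl => x; rewrite invr_eq0.
rewrite (eq_bigr (fun=> -1)) => [|i _].
  by rewrite sumr_const card_ord mulNrn.
have := @sum_pow i (ltn_trans (ltn_ord i) lt_j).
rewrite (bigD1 1) //= expr1n => S0.
by apply/eqP; rewrite -addr_eq0 addrC S0.
Qed.

(** The lower bound in Stickelberger's theorem, by induction on the ternary digits
    of [j]: a new lowest digit 0 is [gauss_frob], and when 3 does not divide i the
    Jacobi sum in [gauss_jacobi] is a unit at the prime, so that passing from i - 1
    to i increases the valuation by that of [gauss 1]. *)
Lemma gauss_valuation k j : (j < q.-1)%N ->
  valuation_ge (ternary_weight k j) (gauss j).
Proof.
elim: k j => [|k IHk] j lt_j /=.
  by have [r] := residue_gauss j; exact: valuation_ge_residue.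
have step i : (0 < i)%N -> (i < q.-1)%N -> ~~ (3 %| i)%N -> forall v,
    valuation_ge v (gauss i.-1) -> valuation_ge v.+1 (gauss i).
  move=> i0 lt_i ndvd v Hv; rewrite -addn1.
  apply: (val_unit (jacobi_residue i0 lt_i)).
    have ch3 : 3%N \in [pchar F] by rewrite inE /= F3 eqxx.
    by rewrite oppr_eq0 -(dvdn_pcharf ch3).
  rewrite -gauss_jacobi //; apply: valM => //; exact: gauss1_valuation.
have : valuation_ge (ternary_weight k (j %/ 3)) (gauss (j %/ 3 * 3)).
  rewrite gauss_frob; last by lia.
  by apply: IHk; lia.
set v := ternary_weight k _; set i := (j %/ 3)%N => V0.
have : (j %% 3 < 3)%N by rewrite ltn_mod.
have Ej := divn_eq j 3; rewrite -/i in Ej.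
case Er: (j %% 3)%N Ej => [|[|[|]]] // Ej _; rewrite ?addn0 in Ej.
- by rewrite add0n Ej.
- by rewrite add1n Ej; apply: (step); rewrite ?addn1 //; lia.
rewrite Ej add2n addn2; apply: (step); [lia|lia|lia|].
by apply: (step) => //=; lia.
Qed.

Lemma chi_eq1 x : (chi x == 1) = (x == 1).
Proof.
have [->|x0] := eqVneq x 0.
  by rewrite chi0; apply/eqP/eqP => /esym/eqP; rewrite oner_eq0.
have [k ->] := dlog x0.
by rewrite chi_g // -(prim_order_dvd z_prim) (prim_order_dvd g_prim).
Qed.

Lemma chiV x : x != 0 -> chi x^-1 = (chi x)^-1.
Proof.
move=> x0; have cx : chi x * chi x^-1 = 1 by rewrite -chiM mulfV ?chi1.
have nz : chi x != 0.
  by apply/eqP => e; move/eqP: cx; rewrite e mul0r eq_sym oner_eq0.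
by apply: (mulfI nz); rewrite cx mulfV.
Qed.

(** The coefficients of (q - 1) psi as a polynomial of degree q - 1 in [chi].  The
    extreme exponents 0 and q - 1 give the same character away from 0; splitting
    its coefficient between them makes the expansion valid at 0 too. *)
Definition fourier_coef (j : nat) : algC :=
  if j == 0 then q.-1%:R else if j == q.-1 then - q%:R else gauss j.

Lemma gauss0 : gauss 0 = -1.
Proof.
rewrite /gauss subn0 (bigD1 0) //= chi0 expr0n eqn0Ngt q1_gt0 mulr0 add0r.
have := sum_psi m_gt0 cardF F3 w_cub; rewrite (bigD1 0) //= psi_0 // => S0.
apply/eqP; rewrite -addr_eq0 addrC; apply/eqP; rewrite -[RHS]S0; congr (_ + _).
by apply: eq_bigr => x x0; rewrite chi_q1 // mulr1.
Qed.

(** Orthogonality of the powers of [chi] as characters of the group F^*. *)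
Lemma fourier y : q.-1%:R * psi y = \sum_(j < q) fourier_coef j * chi y ^+ j.
Proof.
rewrite qE; have [->|y0] := eqVneq y 0.
  rewrite big_ord_recl big1 => [|i _].
    by rewrite psi_0 // expr0 addr0.
  by rewrite chi0 expr0n mulr0.
rewrite big_ord_recr /= chi_q1 // mulr1.
rewrite [X in _ + X](_ : _ = - q%:R); last first.
  by rewrite /fourier_coef eqxx eqn0Ngt q1_gt0.
transitivity (\sum_(j < q.-1) gauss j * chi y ^+ j); last first.
  case E: q.-1 q1_gt0 => [//|n] _; rewrite !big_ord_recl /= expr0 !mulr1 gauss0.
  have -> : fourier_coef 0 = n.+1%:R by rewrite /fourier_coef E.
  rewrite qE E addrAC; congr (_ + _); first by rewrite -[n.+2%:R]natr1; ring.
  apply: eq_bigr => i _; rewrite /fourier_coef /bump /= E add1n eqSS.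
  by rewrite ltn_eqF.
under eq_bigr do rewrite mulr_suml.
rewrite exchange_big /= (bigD1 y) //= [X in _ + X]big1 => [|x xy].
  rewrite addr0 (eq_bigr (fun=> psi y)) => [|j _].
    by rewrite sumr_const card_ord mulr_natl.
  by rewrite -mulrA -exprD subnK ?chi_q1 ?mulr1 // ltnW.
have [->|x0] := eqVneq x 0.
  rewrite big1 // => j _; rewrite chi0 expr0n subn_eq0 leqNgt ltn_ord.
  by rewrite mulr0 mul0r.
rewrite (eq_bigr (fun j : 'I_q.-1 => psi x * chi (y / x) ^+ j)) => [|j _].
  rewrite -mulr_sumr; apply/eqP; rewrite mulf_eq0; apply/orP; right.
  have yx : chi (y / x) - 1 != 0.
    rewrite subr_eq0 chi_eq1; apply: contra xy => /eqP yx1.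
    by rewrite -[x]mul1r -yx1 divfK.
  rewrite -(inj_eq (mulfI yx)) mulr0 -subrX1 chi_q1 ?subrr //.
  by rewrite mulf_neq0 ?invr_eq0.
rewrite -mulrA; congr (_ * _); rewrite chiM chiV // exprMn mulrC; congr (_ * _).
have cx : chi x ^+ j != 0.
  apply/expf_neq0/eqP => cx0; have := chi_q1 x0.
  by move/eqP; rewrite cx0 expr0n eqn0Ngt q1_gt0 eq_sym oner_eq0.
by rewrite exprVn; apply: (mulIf cx); rewrite mulVf // -exprD subnK ?chi_q1 // ltnW.
Qed.

Lemma fourier_coef_valuation j : (j < q)%N ->
  valuation_ge (ternary_weight m j) (fourier_coef j).
Proof.
move=> lt_j; rewrite /fourier_coef; case: eqP => [->|/eqP j0].
  by rewrite ternary_weight0; exact/valuation_ge_residue/residue_nat.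
case: eqP => [->|/eqP jq].
  apply: val_leq (ternary_weight_max m q.-1) _.
  rewrite -mulN1r -[_.*2]add0n; apply: valM; last exact: valuation_ge_3X.
  exact/valuation_ge_residue/residueN/residue1.
by apply: gauss_valuation => //; lia.
Qed.

(** Expanding one factor psi(c x^e): the factor q - 1 is a unit at the prime,
    and the coefficient of chi(x)^(e j) has valuation at least the weight of [j]. *)
Lemma monomial_step n c e (W : F -> algC) :
    (forall j, (j < q)%N ->
       valuation_ge (n - ternary_weight m j) (\sum_x W x * chi x ^+ (e * j))) ->
  valuation_ge n (\sum_x psi (c * x ^+ e) * W x).
Proof.
move=> HW; apply: (val_unit (c := q.-1%:R) (r := -1)).
- have -> : -1 = q.-1%:R :> F.
    have : q%:R = 0 :> F by rewrite natrX F3 expr0n eqn0Ngt m_gt0.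
    by rewrite {1}qE -natr1 => /eqP; rewrite addr_eq0 => /eqP.
  exact: residue_nat.
- by rewrite oppr_eq0 oner_eq0.
rewrite mulr_sumr (eq_bigr (fun x => \sum_(j < q)
   fourier_coef j * chi c ^+ j * (W x * chi x ^+ (e * j)))) => [|x _]; last first.
  rewrite mulrA fourier mulr_suml; apply: eq_bigr => j _.
  by rewrite chiM chiX exprMn -exprM; ring.
rewrite exchange_big /=; apply: val_sum => j _; rewrite -mulr_sumr.
apply: (val_leq (k := ternary_weight m j + 0 + (n - ternary_weight m j))).
  by lia.
apply: valM; last exact: HW.
apply: valM; first exact: fourier_coef_valuation.
exact/valuation_ge_residue/resX/residue_chi.
Qed.

(** * The character sums of the Dickson polynomial *)

Variable u : F.
Hypotheses (m_odd : odd m) (m_mod3 : (m != 0 %[mod 3])%N) (u_neq0 : u != 0).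
Local Notation h := (q./2).
Local Notation D := (dickson7_fun u).

Let half_q : (h.*2 = q.-1)%N. Proof. exact: half_exp3. Qed.
Let half_q_odd : odd h. Proof. exact: odd_half_exp3. Qed.

Definition char_sum (a : F) : algC := \sum_x chi x ^+ h * psi (a * D x).

(** Expand the four monomials of D_7.  The sum over x of a power of [chi] vanishes
    unless q - 1 divides the exponent, and then [weight_bound] says that the
    coefficients already contribute a valuation of at least [m]. *)
Lemma char_sum_valuation a : valuation_ge m (char_sum a).
Proof.
have -> : char_sum a = \sum_x psi (a * x ^+ 7) * (psi (- (a * u) * x ^+ 5)
    * (psi (- (a * u ^+ 2) * x ^+ 3) * (psi (- (a * u ^+ 3) * x ^+ 1)
    * chi x ^+ h))).
  apply: eq_bigr => x _; rewrite !mulrA -!psiD // mulrC; congr (psi _ * _).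
  by rewrite /dickson7_fun; ring.
apply: monomial_step => j1 l1; under eq_bigr do rewrite -!mulrA.
apply: monomial_step => j2 l2; under eq_bigr do rewrite -!mulrA.
apply: monomial_step => j3 l3; under eq_bigr do rewrite -!mulrA.
apply: monomial_step => j4 l4.
rewrite (eq_bigr (fun x => chi x ^+ (h + 7 * j1 + 5 * j2 + 3 * j3 + j4)))
  => [|x _]; last by rewrite -!mulrA -!exprD; congr (_ ^+ _); lia.
have [dv|ndv] := boolP (q.-1 %| h + 7 * j1 + 5 * j2 + 3 * j3 + j4)%N; last first.
  by rewrite sum_chi0 //; exact: valuation_ge0.
rewrite (_ : (_ - _ = 0)%N); last by have := weight_bound l1 l2 l3 l4 dv; lia.
rewrite sum_chi_dvd //; last by have := half_q_odd; case: h => // k; lia.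
exact/valuation_ge_residue/residue_nat.
Qed.

(** The quadratic character, by Euler's criterion. *)
Definition eta (x : F) : int := if x == 0 then 0 else if x ^+ h == 1 then 1 else -1.

Let h_gt0 : (0 < h)%N. Proof. by have := half_q_odd; case: h. Qed.

Lemma expf_h (x : F) : x != 0 -> (x ^+ h == 1) || (x ^+ h == -1).
Proof.
move=> x0; have := expf_q1 x0; rewrite -half_q -mul2n mulnC exprM => /eqP.
by rewrite sqrf_eq1.
Qed.

Lemma chiN1 : chi (-1) = -1.
Proof.
have : chi (-1) ^+ 2 == 1 by rewrite -chiX sqrrN expr1n chi1.
rewrite sqrf_eq1 chi_eq1 eq_sym (negbTE (one_neqN1 F3)) /=; exact/eqP.
Qed.

Lemma eta_chi x : (eta x)%:~R = chi x ^+ h.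
Proof.
rewrite /eta -chiX; case: eqP => [->|/eqP x0].
  by rewrite expr0n eqn0Ngt h_gt0 chi0.
have := expf_h x0; case: eqP => [->|_ /eqP ->]; first by rewrite chi1.
by rewrite chiN1.
Qed.

Lemma etaN x : eta (- x) = - eta x.
Proof.
apply: (intr_inj (R := algC)); rewrite rmorphN /= !eta_chi -(mulN1r x) chiM chiN1.
by rewrite exprMn -signr_odd half_q_odd mulN1r.
Qed.

(** [char_sum a] divided by w - w^2, a square root of -3. *)
Definition imag_sum (a : F) : int := \sum_(x | tr3 m (a * D x) == 1) eta x.

Lemma sum_eta_trN1 a : \sum_(x | tr3 m (a * D x) == -1) eta x = - imag_sum a.
Proof.
rewrite (reindex_inj oppr_inj) /= /imag_sum -sumrN; apply: eq_big => [x|x _].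
  by rewrite dickson7_funN mulrN tr3N // eqr_opp.
exact: etaN.
Qed.

(** Both [eta] and D_7 are odd, so replacing x by - x changes [char_sum a] into the
    opposite of its complex conjugate: the values of trace 0 cancel, and those of
    trace 1 and -1 combine into the purely imaginary number w - w^2. *)
Lemma char_sumE a : char_sum a = (imag_sum a)%:~R * (w - w ^+ 2).
Proof.
have char_sumN : char_sum a = - \sum_x chi x ^+ h * psi (- (a * D x)).
  rewrite /char_sum (reindex_inj oppr_inj) -sumrN; apply: eq_bigr => x _ /=.
  by rewrite dickson7_funN mulrN -!eta_chi etaN rmorphN mulNr.
have two : 2 != 0 :> algC by rewrite pnatr_eq0.
apply: (mulfI two); rewrite mulr_natl mulr2n {2}char_sumN /char_sum -sumrB.
have psi_odd t : psi t - psi (- t)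
    = (tr3 m t == 1)%:R * (w - w ^+ 2) - (tr3 m t == -1)%:R * (w - w ^+ 2).
  have e10 : (1 == 0 :> F) = false by exact: oner_eq0.
  have e01 : (0 == 1 :> F) = false by rewrite eq_sym.
  have eN0 : (-1 == 0 :> F) = false by rewrite oppr_eq0.
  have e0N : (0 == -1 :> F) = false by rewrite eq_sym.
  have e1N : (1 == -1 :> F) = false by rewrite (negbTE (one_neqN1 F3)).
  have eN1 : (-1 == 1 :> F) = false by rewrite eq_sym.
  rewrite /psi tr3N //; case/or3P: (tr3_val m_gt0 cardF F3 t) => /eqP->;
    by rewrite !(oppr0, opprK, eqxx, e10, e01, eN0, e0N, e1N, eN1) /=; ring.
transitivity (\sum_x ((tr3 m (a * D x) == 1)%:R * (eta x)%:~R
   - (tr3 m (a * D x) == -1)%:R * (eta x)%:~R) * (w - w ^+ 2) : algC).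
  by apply: eq_bigr => x _; rewrite -mulrBr psi_odd -eta_chi; ring.
rewrite -mulr_suml mulrA; congr (_ * _); rewrite sumrB.
have sumE (c : F) : \sum_x (tr3 m (a * D x) == c)%:R * (eta x)%:~R
    = (\sum_(x | tr3 m (a * D x) == c) eta x)%:~R :> algC.
  rewrite rmorph_sum /= [RHS]big_mkcond /=; apply: eq_bigr => x _.
  by case: ifP; rewrite ?mul1r ?mul0r.
by rewrite !sumE sum_eta_trN1 rmorphN /= opprK; ring.
Qed.

Lemma imag_sum_dvd a : (3 ^ m./2 %| `|imag_sum a|)%N.
Proof.
apply: (valuation_ge_dvd3 F3 g_prim z_prim w_cub).
rewrite -char_sumE (_ : _.*2.+1 = m); first exact: char_sum_valuation.
by rewrite -[RHS]odd_double_half m_odd.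
Qed.

Let D_inj : injective D. Proof. exact: dickson7_fun_inj cardF u_neq0. Qed.

(** The number of terms of [imag_sum a] is odd because D_7 is a permutation, and
    each term is 1 or -1, so the sum is odd. *)
Lemma imag_sum_neq0 a : a != 0 -> imag_sum a != 0.
Proof.
move=> a0; pose A := [set x | tr3 m (a * D x) == 1].
have oddA : odd #|A|.
  rewrite -(card_imset _ (inj_comp (mulfI a0) D_inj)).
  rewrite (_ : _ @: _ = [set y | tr3 m y == 1]); first exact: card_tr3.
  have [E _ DE] := injF_bij D_inj.
  apply/setP => y; rewrite inE; apply/imsetP/idP => [[x]|ty].
    by rewrite inE => tx ->.
  by exists (E (a^-1 * y)); rewrite ?inE /= DE mulVKf.
have : imag_sum a = (#|A|%:Z - (\sum_(x in A) (eta x != 1)%:Z) * 2).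
  rewrite -natz mulr_suml -sum1_card natr_sum -sumrB /imag_sum.
  apply: eq_big => [x|x tx]; first by rewrite inE.
  rewrite /eta; case: eqP => [x0|_]; last by case: ifP.
  by move: tx; rewrite x0 dickson7_fun0 mulr0 tr3_0 // eq_sym oner_eq0.
move=> ->; apply/eqP; move: (\sum_(x in A) _) => s; lia.
Qed.

Lemma imag_sum0 : imag_sum 0 = 0.
Proof.
by rewrite /imag_sum big_pred0 // => x; rewrite mul0r tr3_0 // eq_sym oner_eq0.
Qed.

Lemma char_sum_sqE a : char_sum a ^+ 2 = - (3 * imag_sum a ^+ 2)%:~R.
Proof.
rewrite char_sumE exprMn !rmorphM /=.
have -> : (w - w ^+ 2) ^+ 2 = -3%:R.
  apply/eqP; rewrite -subr_eq0 opprK -(mulr0 (w ^+ 2 - w *+ 3 + 3)) -w_cub.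
  by apply/eqP; ring.
by ring.
Qed.

Lemma char_sum_opp a : char_sum (- a) = - char_sum a.
Proof.
rewrite /char_sum (reindex_inj oppr_inj) -sumrN; apply: eq_bigr => x _ /=.
by rewrite dickson7_funN mulrNN -!eta_chi etaN rmorphN mulNr.
Qed.

(** Orthogonality of the additive characters leaves the pairs with equal images
    under D_7, that is, the diagonal. *)
Lemma parseval : \sum_a imag_sum a ^+ 2 = (3 ^ m.-1 * q.-1)%:Z.
Proof.
have key : \sum_a (3 * imag_sum a ^+ 2)%:~R = (q * q.-1)%:R :> algC.
  transitivity (\sum_a char_sum a * char_sum (- a)).
    apply: eq_bigr => a _.
    by rewrite char_sum_opp mulrN -expr2 char_sum_sqE opprK.
  transitivity (\sum_x \sum_y chi x ^+ h * chi y ^+ h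
                  * \sum_a psi ((D x - D y) * a)).
    under eq_bigr do rewrite mulr_suml.
    rewrite exchange_big /=; apply: eq_bigr => x _.
    under eq_bigr do rewrite mulr_sumr.
    rewrite exchange_big /=; apply: eq_bigr => y _.
    rewrite mulr_sumr; apply: eq_bigr => a _.
    rewrite mulrACA -psiD //; congr (_ * psi _); ring.
  transitivity (\sum_(x : F) (x != 0)%:R * q%:R : algC); last first.
    rewrite -mulr_suml natrM mulrC; congr (_ * _).
    rewrite -natr_sum -cardF -(cardC1 (0 : F)) -sum1_card [in RHS]big_mkcond /=.
    by congr _%:R; apply: eq_bigr => x _; rewrite inE; case: eqP.
  apply: eq_bigr => x _; rewrite (bigD1 x) //=.
  rewrite [X in _ + X]big1 => [|y yx]; last first.
    by rewrite sum_psiM // subr_eq0 (inj_eq D_inj) eq_sym (negbTE yx) mulr0.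
  rewrite addr0 sum_psiM // subrr eqxx; congr (_ * _).
  rewrite -exprD addnn half_q; have [->|x0] := eqVneq x 0; last exact: chi_q1.
  by rewrite chi0 expr0n eqn0Ngt q1_gt0.
have nz3 : 3 != 0 :> int by [].
apply: (mulfI nz3); rewrite mulr_sumr; apply: (intr_inj (R := algC)).
by rewrite rmorph_sum /= key rmorphM /= -!pmulrn -natrM mulnA -expnS prednK.
Qed.

(** Every [imag_sum a] with a <> 0 is a nonzero multiple of 3^((m-1)/2), so its
    square is at least 3^(m-1), which by [parseval] is the average of the squares. *)
Lemma imag_sum_sqr a : a != 0 -> imag_sum a ^+ 2 = (3 ^ m.-1)%:Z.
Proof.
move=> a0; set T := (3 ^ m.-1)%:Z.
have sqrE (M : int) : M ^+ 2 = (`|M| ^ 2)%N%:Z.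
  by case: M => n; rewrite ?NegzE ?sqrrN ?abszN !expr2 -PoszM -mulnn.
have le_T b : b != 0 -> 0 <= imag_sum b ^+ 2 - T.
  move=> b0; rewrite subr_ge0 /T sqrE lez_nat.
  have -> : m.-1 = (m./2 * 2)%N.
    by have := odd_double_half m; rewrite m_odd; lia.
  rewrite expnM leq_exp2r //; apply: dvdn_leq (imag_sum_dvd b).
  by rewrite absz_gt0 imag_sum_neq0.
have sum0 : \sum_(b | b != 0) (imag_sum b ^+ 2 - T) = 0.
  rewrite sumrB sumr_const (cardC1 0) cardF.
  have := parseval; rewrite (bigD1 0) //= imag_sum0 expr0n add0r => ->.
  by rewrite PoszM -mulr_natr natz subrr.
by apply/eqP; rewrite -subr_eq0; apply/eqP; exact: (psumr_eq0P le_T sum0).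
Qed.

Lemma char_sum_sqr a : a != 0 -> char_sum a ^+ 2 = - q%:R.
Proof.
by move=> a0; rewrite char_sum_sqE imag_sum_sqr // -PoszM -expnS prednK.
Qed.

(** * The difference set *)

(** The image under D_7 of the nonzero squares of F. *)
Definition half_set : {set F} := D @: [set x | x ^+ h == 1].

Definition half_sum (a : F) : algC := \sum_(d in half_set) psi (a * d).

(** For x <> 0, (1 + eta(x)) / 2 is the indicator of the squares. *)
Lemma half_sumE a : a != 0 -> half_sum a *+ 2 = char_sum a - 1.
Proof.
move=> a0; rewrite /half_sum big_imset /=; last by move=> x y _ _; exact: D_inj.
have tot : \sum_x psi (a * D x) = 0.
  rewrite -[RHS](sum_psi m_gt0 cardF F3 w_cub) [RHS](reindex_inj (mulfI a0)) /=.
  by rewrite [RHS](reindex_inj D_inj).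
rewrite -[char_sum a]addr0 -[X in _ + X - _]tot /char_sum -big_split /=.
rewrite [in RHS](bigD1 0) //= chi0 expr0n eqn0Ngt h_gt0 mul0r add0r.
rewrite dickson7_fun0 mulr0 psi_0 // addrAC subrr add0r -sumrMnl.
rewrite big_mkcond [RHS]big_mkcond /=; apply: eq_bigr => x _; rewrite inE.
case: eqP => [xh|/eqP xh].
  have -> : x != 0.
    apply/eqP => x0; move/eqP: xh.
    by rewrite x0 expr0n eqn0Ngt h_gt0 eq_sym oner_eq0.
  by rewrite -chiX xh chi1 mul1r mulr2n.
case: eqP => //= /eqP x0; have := expf_h x0; rewrite (negbTE xh) => /eqP xh1.
by rewrite -chiX xh1 chiN1 mulN1r addNr.
Qed.

(** Since [char_sum] is odd with square - q, the product is the same for all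
    nontrivial characters: this is what makes [half_set] a difference set. *)
Lemma half_sum_mul a : a != 0 -> half_sum a * half_sum (- a) *+ 4 = 1 + q%:R.
Proof.
move=> a0; transitivity ((half_sum a *+ 2) * (half_sum (- a) *+ 2)); first by ring.
rewrite !half_sumE ?oppr_eq0 // char_sum_opp.
transitivity (1 - char_sum a ^+ 2); first by ring.
by rewrite char_sum_sqr // opprK.
Qed.

Definition nb_diff (t : F) : nat :=
  #|[set d : F * F | [&& d.1 \in half_set, d.2 \in half_set, d.1 != d.2
                        & d.1 - d.2 == t]]|.

(** Fourier inversion: q times the number of representations of [t] as a difference
    is the sum over a of |half_sum a|^2 psi(- t a), and for t <> 0 the values
    psi(- t a) with a <> 0 sum to -1.  The result does not depend on [t]. *)
Lemma nb_diff_count t : t != 0 ->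
  q%:R * (nb_diff t)%:R *+ 4 = #|half_set|%:R ^+ 2 *+ 4 - 1 - q%:R :> algC.
Proof.
move=> t0.
have -> : q%:R * (nb_diff t)%:R
    = \sum_a half_sum a * half_sum (- a) * psi (- (t * a)).
  transitivity (\sum_(d1 in half_set) \sum_(d2 in half_set)
                  \sum_a psi ((d1 - d2 - t) * a)).
    rewrite pair_big /= mulrC /nb_diff -sum1_card natr_sum mulr_suml.
    rewrite big_mkcond [RHS]big_mkcond /=; apply: eq_bigr => -[d1 d2] _ /=.
    rewrite inE /= sum_psiM // subr_eq0; case: (d1 \in _); case: (d2 \in _) => //=.
    case: (d1 - d2 =P t) => [dt|]; rewrite ?andbF // andbT.
    by rewrite -subr_eq0 dt t0 mul1r.
  rewrite (eq_bigr (fun d1 => \sum_a \sum_(d2 in half_set)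
      psi ((d1 - d2 - t) * a))) => [|d1 _]; last exact: exchange_big.
  rewrite exchange_big /=; apply: eq_bigr => a _.
  rewrite /half_sum !mulr_suml; apply: eq_bigr => d1 _.
  rewrite mulr_sumr mulr_suml; apply: eq_bigr => d2 _.
  by rewrite -!psiD //; congr psi; ring.
rewrite (bigD1 0) //= mulr0 oppr0 psi_0 // mulr1.
have -> : half_sum 0 = #|half_set|%:R.
  rewrite /half_sum (eq_bigr (fun=> 1)) => [|d _]; last by rewrite mul0r psi_0.
  by rewrite sumr_const.
rewrite -expr2 mulrnDl -[RHS]addrA; congr (_ + _).
rewrite -sumrMnl (eq_bigr (fun a => (1 + q%:R) * psi (- t * a))) => [|a a0].
  have := sum_psiM m_gt0 cardF F3 w_cub (- t).
  rewrite oppr_eq0 (negbTE t0) (bigD1 0) //= mulr0 psi_0 // => S0.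
  rewrite -mulr_sumr.
  have -> : \sum_(i | i != 0) psi (- t * i) = -1.
    by apply/eqP; rewrite -addr_eq0 addrC S0.
  by ring.
by rewrite -mulrnAl half_sum_mul // mulNr.
Qed.

(** As h = (q - 1) / 2 is odd, x^h = 1 makes x the square of x^((h + 1) / 2). *)
Lemma half_setE : dickson7_set u = half_set.
Proof.
apply/setP => y; apply/imsetP/imsetP => [[x x0]|[x xh]] ->.
  exists (x ^+ 2); last exact: horner_dickson7.
  by rewrite inE -exprM mul2n half_q expf_q1 // -in_setC1.
move: xh; rewrite inE => /eqP xh.
have Eh : (h.+1./2.*2 = h.+1)%N.
  by rewrite -[RHS]odd_double_half /= half_q_odd.
have sqx : (x ^+ h.+1./2) ^+ 2 = x.
  by rewrite -exprM muln2 Eh exprS xh mulr1.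
exists (x ^+ h.+1./2); last by rewrite sqx horner_dickson7.
rewrite in_setC1; apply/eqP => x0; move/eqP: xh.
have -> : x = 0 by rewrite -sqx x0 expr0n.
by rewrite expr0n eqn0Ngt h_gt0 eq_sym oner_eq0.
Qed.

Lemma skew_half_set : skew_hadamard_difference_set half_set.
Proof.
have oppE y : (- y \in half_set) = (y \in opp_set half_set).
  apply/idP/imsetP => [yD|[d dD ->]]; last by rewrite opprK.
  by exists (- y); rewrite ?opprK.
have zero : 0 \notin half_set.
  apply/imsetP => -[x]; rewrite inE => /eqP xh /esym.
  rewrite -(dickson7_fun0 u) => /D_inj x0.
  by move/eqP: xh; rewrite x0 expr0n eqn0Ngt h_gt0 eq_sym oner_eq0.
have disj y : y \in half_set -> - y \notin half_set.
  case/imsetP=> x; rewrite inE => /eqP xh ->; apply/imsetP => -[t].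
  rewrite inE => /eqP th; rewrite -dickson7_funN => /D_inj xt.
  move: th; rewrite -xt exprNn xh mulr1 -signr_odd half_q_odd => /eqP.
  by rewrite eq_sym (negbTE (one_neqN1 F3)).
have cover y : y != 0 -> (y \in half_set) || (- y \in half_set).
  have [E _ DE] := injF_bij D_inj; rewrite -(DE y) => y0.
  have x0 : E y != 0 by apply: contraNneq y0 => ->; rewrite dickson7_fun0.
  case/orP: (expf_h x0) => xh; apply/orP; [left | right].
    by apply/imsetP; exists (E y); rewrite ?inE.
  rewrite -dickson7_funN; apply/imsetP; exists (- E y) => //.
  by rewrite inE exprNn -signr_odd half_q_odd (eqP xh) mulrNN mulr1.
split.
  exists #|F|, #|half_set|, (nb_diff 1); split=> // t t0.
  have q0 : q%:R != 0 :> algC by rewrite pnatr_eq0 -lt0n expn_gt0.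
  have four : 4 != 0 :> algC by rewrite pnatr_eq0.
  apply/eqP; rewrite -(eqr_nat algC); apply/eqP/(mulfI q0)/(mulIf four).
  by rewrite !(mulr_natr _ 4) (nb_diff_count t0) (nb_diff_count (oner_neq0 F)).
split.
- apply/setP => y; rewrite !inE -oppE.
  by have [->|/cover->] := eqVneq y 0; rewrite ?orbT.
- rewrite disjoints_subset; apply/subsetP => y yD.
  by rewrite inE -oppE disj.
- by rewrite disjoint_sym disjoints1.
by rewrite disjoint_sym disjoints1 -oppE oppr0.
Qed.
End Gauss.

Theorem theorem2 (m : nat) (m_gt0 : (0 < m)%N) (m_odd : odd m)
    (m_mod3 : (m != 0 %[mod 3])%N) (F : finFieldType) (cardF : #|F| = (3 ^ m)%N)
    (u : F) (u_neq0 : u != 0) :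
  skew_hadamard_difference_set (dickson7_set u).
Proof.
have F3 := natr3_card m_gt0 cardF.
have q1 := pred_exp3_gt0 m_gt0.
have [z z_prim] := C_prim_root_exists q1.
have [g g_prim] : exists g : F, (3 ^ m).-1.-primitive_root g.
  have /hasP[g _ gP] : has (3 ^ m).-1.-primitive_root (enum [set~ (0 : F)]).
    apply: has_prim_root => //.
    - apply/allP => x; rewrite mem_enum in_setC1 => x0.
      by rewrite unity_rootE (expf_q1 cardF).
    - exact: enum_uniq.
    by rewrite -cardE cardsC1 cardF.
  by exists g.
have [w w_prim] := C_prim_root_exists (isT : 0 < 3)%N.
have w_cub : w ^+ 2 + w + 1 = 0.
  have nz : w - 1 != 0.
    by rewrite subr_eq0 -[w]expr1 -(prim_order_dvd w_prim).
  apply: (mulfI nz); rewrite mulr0; transitivity (w ^+ 3 - 1); first by ring.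
  by rewrite (prim_expr_order w_prim) subrr.
rewrite (half_setE cardF F3 u m_odd).
exact: (skew_half_set m_gt0 cardF F3 g_prim z_prim w_cub m_odd m_mod3 u_neq0).
Qed.
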